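(* Let $E$ be a $\mathbb{C}$-vector space that is the union of an increasing sequence of vector subspaces $(E_n)_{n\in\mathbb{N}}$. Assume that a norm $\|\cdot\|_{E_n}$ is given on each $E_n$ such that all bonding maps $i_n\colon E_n\to E_{n+1},\ x\mapsto x$ are continuous and have operator norm at most $1$. Give $E$ the locally convex direct limit topology and assume that it is Hausdorff. Let $R>0$ and let $U:=\bigcup_{n\in\mathbb{N}} B_R^{E_n}(0)$ be the union of all open balls of radius $R$ around $0$. Let $f\colon U\to F$ be a function with values in a locally convex space $F$ (over $\mathbb{C}$) such that each $f_n:=f|_{B_R^{E_n}(0)}$ is $\mathbb{C}$-analytic (as a map on the open ball of the normed space $(E_n,\|\cdot\|_{E_n})$) and bounded. Then $f$ is $\mathbb{C}$-analytic.
   Context: $B_R^{E_n}(0)=\{x\in E_n:\|x\|_{E_n}<R\}$. Locally convex direct limit topology on $E=\bigcup_n E_n$: the locally convex vector topology in which a convex subset $W\subseteq E$ is a $0$-neighborhood if and only if $W\cap E_n$ is a $0$-neighborhood in $E_n$ for each $n\in\mathbb{N}$. Complex analytic: let $E,F$ be complex locally convex spaces and $U\subseteq E$ open. A map $f\colon U\to F$ is complex analytic ($\mathbb{C}$-analytic, $C^\omega_{\mathbb{C}}$) if it is continuous and for each $a\in U$ there are continuous homogeneous polynomials $p_k\colon E\to F$ of degree $k$ ($k=0,1,2,\dots$) such that $f(x)=\sum_{k=0}^\infty p_k(x-a)$ for all $x$ in a neighborhood of $a$. A map into a locally convex space is bounded if its image is a bounded set. *)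

(* Defs.v *)
From HB Require Import structures.
From mathcomp Require Import all_boot all_order all_algebra.
From mathcomp Require Import all_classical all_reals all_analysis.
From mathcomp Require Import complex.

Set Implicit Arguments.
Unset Strict Implicit.
Unset Printing Implicit Defensive.

Import Order.TTheory GRing.Theory Num.Theory.
Import numFieldNormedType.Exports.

Local Open Scope classical_set_scope.
Local Open Scope ring_scope.

(* The complex numbers are [R[i]] for [R : realType].
   A [tvsType K] is a locally convex space over [K]; it need not be Hausdorff.
   In [R[i]], [0 <= t] entails that [t] is real, so that [convex_set] over
   [R[i]] is ordinary (real) convexity. *)

Section Analytic.
Context {K : numFieldType}.

Definition multilinear (V W : lmodType K) (k : nat)
    (b : ('I_k -> V) -> W) : Prop :=
  forall (i : 'I_k) (v : 'I_k -> V), linear (fun x : V => b (dfwith v i x)).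

Definition homogeneous_poly (V W : lmodType K) (k : nat) (p : V -> W) : Prop :=
  exists b : ('I_k -> V) -> W, multilinear b /\ forall x, p x = b (fun=> x).

(* A map [f : U -> F] is represented by a total function whose values outside
   [U] are irrelevant. *)
Definition analytic_on (E F : tvsType K) (U : set E) (f : E -> F) : Prop :=
  [/\ open U,
      {within U, continuous f} &
      forall a, U a -> exists p : nat -> E -> F,
        (forall k, homogeneous_poly k (p k) /\ continuous (p k)) /\
        \forall x \near a, series (fun k => p k (x - a)) @ \oo --> f x].

(* [bounded_set] of the library is about norms; this is boundedness in a
   topological vector space. *)
Definition tvs_bounded (F : tvsType K) (B : set F) : Prop :=
  forall V : set F, nbhs 0 V ->
    exists2 t : K, 0 < t & B `<=` [set t *: v | v in V].

(* As [E] is locally convex, this determines its topology. The intersection of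
   [W] with [En n] is its preimage under the inclusion. *)
Definition lc_direct_limit (E : tvsType K) (En : nat -> normedModType K)
    (incl : forall n, {linear En n -> E}) : Prop :=
  forall W : set E, convex_set W ->
    nbhs 0 W <-> forall n, nbhs 0 (incl n @^-1` W).

End Analytic.

(* Norms over [R[i]] take values in [R[i]] and are real. *)
Definition op_norm (R : realType) (V W : normedModType R[i]) (u : V -> W)
    : \bar R :=
  ereal_sup [set (complex.Re `|u x|)%:E | x in [set x : V | `|x| <= 1]].

(* Main.v *)
Require Import Defs.
From HB Require Import structures.
From mathcomp Require Import all_boot all_order all_algebra.
From mathcomp Require Import all_classical all_reals all_analysis.
From mathcomp Require Import complex.
From mathcomp Require Import separable ring lra.
From mathcomp Require cyclic cyclotomic.
Import Order.TTheory GRing.Theory Num.Theory.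
Import numFieldNormedType.Exports.
Local Open Scope classical_set_scope.
Local Open Scope ring_scope.
Local Open Scope complex_scope.

(** Let [a] be a point of the union of balls, say [a] in [En 0] after dropping
    finitely many spaces, and let [2 * rho] be [r] minus the norm of [a]. As the
    bonding maps do not increase norms, every [En n] has a ball of radius
    [2 * rho] around [a] on which the restriction of [f] is analytic and bounded
    with respect to each continuous seminorm, by a constant that depends on [n].

    In one space [En n] this yields, with radii that do not depend on [n], that
    the Taylor series at [a] represents [f] on the whole ball
    ([expansion_disc]), and Lipschitz estimates for [f] and for its Taylor
    polynomials ([analytic_lipschitz], [expansion_lipschitz]). Restriction to
    complex lines reduces this to power series in one variable with coefficients
    in [F]. The theory is developed without integrals, for one seminorm at a
    time: averages over roots of unity give Cauchy's estimates ([cauchy_psum]),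
    and an argument of Weierstrass together with the compactness of discs shows
    that the Taylor series of a bounded, locally analytic function on a disc
    represents it on the entire disc ([hassum_maximal_disc]).

    A map on [E] that satisfies Lipschitz estimates on balls of one radius in all
    [En n] is continuous, however fast the Lipschitz constants grow with [n]: a
    typical neighbourhood of [0] in the locally convex direct limit is the
    algebraic sum of balls of radii [eps n] in [En n], and small [eps n] make up
    for large constants ([lipschitz_continuous_at]). This gives the continuity of
    [f], and also of the Taylor polynomials once they are glued to maps on [E].
    Since the Taylor series represents [f] on balls of the same radius in all
    [En n], it does so on a neighbourhood of [a] in [E].

    The glued maps must be homogeneous polynomials on [E]. Multilinear forms for
    them are provided by the polarization formula
    ([homogeneous_poly_limit]). As [F] may fail to be Hausdorff, the Taylor
    polynomials are unique only up to the closure of [0]; they are made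
    compatible by a linear projection along this closure
    ([exists_projection]). *)

(** * Real-valued norms *)

Section RNorm.
Context {R : realType}.

(** Norms over [R[i]] have values in [R[i]]; estimates are easier for their real
    parts, which live in a totally ordered field. *)
Definition rnorm {V : normedZmodType R[i]} (x : V) : R := complex.Re `|x|.

Section Zmod.
Context {V : normedZmodType R[i]}.
Implicit Types x y : V.

Lemma rnormE x : `|x| = (rnorm x)%:C.
Proof. by rewrite /rnorm RRe_real // normr_real. Qed.

Lemma rnorm_ge0 x : 0 <= rnorm x.
Proof. by rewrite -ler0c -rnormE. Qed.

Lemma rnormD x y : rnorm (x + y) <= rnorm x + rnorm y.
Proof. by rewrite -lecR rmorphD /= -!rnormE ler_normD. Qed.

Lemma rnorm0 : rnorm (0 : V) = 0.
Proof. by rewrite /rnorm normr0. Qed.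

Lemma rnormN x : rnorm (- x) = rnorm x.
Proof. by rewrite /rnorm normrN. Qed.

Lemma rnormB x y : rnorm (x - y) = rnorm (y - x).
Proof. by rewrite -rnormN opprB. Qed.

Lemma rnorm_eq0 x : (rnorm x == 0) = (x == 0).
Proof. by rewrite -(inj_eq (@complexI R)) -rnormE normr_eq0. Qed.

Lemma rnorm_gt0 x : (0 < rnorm x) = (x != 0).
Proof. by rewrite lt_neqAle eq_sym rnorm_eq0 rnorm_ge0 andbT. Qed.
End Zmod.

Implicit Types z w : R[i].

Lemma rnormM z w : rnorm (z * w) = rnorm z * rnorm w.
Proof. by apply: complexI; rewrite rmorphM /= -!rnormE normrM. Qed.

Lemma rnormX z n : rnorm (z ^+ n) = rnorm z ^+ n.
Proof. by apply: complexI; rewrite rmorphXn /= -!rnormE normrX. Qed.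

Lemma rnormV z : rnorm z^-1 = (rnorm z)^-1.
Proof. by apply: complexI; rewrite fmorphV /= -!rnormE normfV. Qed.

Lemma rnorm_real (t : R) : 0 <= t -> rnorm t%:C = t.
Proof. by move=> t0; rewrite /rnorm ger0_norm // ler0c. Qed.

Lemma rnorm1 : rnorm (1 : R[i]) = 1.
Proof. exact: rnorm_real. Qed.

Lemma rnorm_Creal (t : R) : rnorm t%:C = `|t|.
Proof.
by apply: complexI; rewrite -rnormE normc_def /= expr0n addr0 sqrtr_sqr.
Qed.

Lemma rnorm_i : rnorm ('i%C : R[i]) = 1.
Proof.
by apply: complexI; rewrite -rnormE normc_def /= expr0n add0r expr1n sqrtr1.
Qed.

Lemma rnorm_nat (n : nat) : rnorm (n%:R : R[i]) = n%:R.
Proof. by rewrite -(rmorph_nat (real_complex R)) rnorm_real. Qed.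

Lemma rnorm_le_ReIm z : rnorm z <= `|complex.Re z| + `|complex.Im z|.
Proof.
have -> : z = (complex.Re z)%:C + 'i%C * (complex.Im z)%:C by exact: complexE.
rewrite (le_trans (rnormD _ _)) // rnormM !(rnorm_Creal, rnorm_i) mul1r.
by case: z => x y /=; rewrite !(mul0r,mul1r,addr0,add0r,subr0,mulr0).
Qed.

Lemma ler_Re_rnorm z : `|complex.Re z| <= rnorm z.
Proof. by rewrite -lecR -rnormE normc_ge_Re. Qed.

Lemma ler_Im_rnorm z : `|complex.Im z| <= rnorm z.
Proof.
have := ler_Re_rnorm (z * 'i%C).
by rewrite ReiNIm normrN rnormM rnorm_i mulr1.
Qed.

Lemma prim_root_complex (n : nat) : (0 < n)%N ->
  exists2 w : R[i], n.-primitive_root w & rnorm w = 1.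
Proof.
move=> n0; pose p : {poly R[i]} := 'X^n - 1.
have [r Dp] := closed_field_poly_normal p.
move: Dp; rewrite (monicP _) ?monicXnsubC // scale1r => Dp.
have rn : all n.-unity_root r.
  apply/allP=> z; rewrite unity_rootE -root_prod_XsubC -Dp.
  by rewrite rootE !hornerE subr_eq0.
have szr : (n < (size r).+1)%N.
  by rewrite -(size_prod_XsubC r id) -Dp size_XnsubC.
have ur : uniq r.
  rewrite -separable_prod_XsubC -Dp cyclotomic.separable_Xn_sub_1 //.
  by rewrite pnatr_eq0 -lt0n.
have /hasP[w _ pw] := cyclic.has_prim_root n0 rn ur szr.
exists w => //.
have /(congr1 rnorm) := prim_expr_order pw.
rewrite rnormX rnorm1 => /eqP.
by rewrite pexpr_eq1 ?rnorm_ge0 // => /eqP.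
Qed.

End RNorm.

(** * Partial sums of power series *)

Section PowerSeries.
Set Implicit Arguments.
Unset Strict Implicit.
Context {R : realType} {F : lmodType R[i]}.
Implicit Types (z w : R[i]) (c : nat -> F) (x y : F).

Definition seminorm (q : F -> R) : Prop :=
  (forall x y, q (x + y) <= q x + q y) /\
  (forall (a : R[i]) x, q (a *: x) = rnorm a * q x).

Definition psum c d z : F := \sum_(k < d) z ^+ k *: c k.

(** Convergence is measured by one seminorm at a time: [F] is neither complete
    nor separated, so a power series need not have a sum, nor just one, and the
    candidate [y] is always given. *)
Definition hassum (q : F -> R) c z y : Prop :=
  forall e : R, 0 < e -> \forall d \near \oo, q (y - psum c d z) <= e.

Section Seminorm.
Context {q : F -> R} (qS : seminorm q).

Lemma snormD x y : q (x + y) <= q x + q y. Proof. exact: qS.1. Qed.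
Lemma snormZ (a : R[i]) x : q (a *: x) = rnorm a * q x. Proof. exact: qS.2. Qed.
Lemma snorm0 : q 0 = 0.
Proof. by rewrite -(scale0r (0 : F)) snormZ rnorm0 mul0r. Qed.
Lemma snormN x : q (- x) = q x.
Proof. by rewrite -scaleN1r snormZ rnormN rnorm1 mul1r. Qed.
Lemma snormBC x y : q (x - y) = q (y - x).
Proof. by rewrite -snormN opprB. Qed.
Lemma snorm_ge0 x : 0 <= q x.
Proof.
have := snormD x (- x); rewrite subrr snorm0 snormN -mulr2n pmulrn_lge0 //.
Qed.
Lemma snormB x y : q (x - y) <= q x + q y.
Proof. by rewrite -(snormN y) snormD. Qed.
Lemma snorm_tri y x v : q (x - v) <= q (x - y) + q (y - v).
Proof. by rewrite (le_trans _ (snormD _ _)) // addrA subrK. Qed.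
Lemma snorm_leD x y : q x <= q y + q (x - y).
Proof. by rewrite (le_trans _ (snormD _ _)) // addrC subrK. Qed.
Lemma snorm_sum (I : Type) (r : seq I) (P : pred I) (f : I -> F) :
  q (\sum_(i <- r | P i) f i) <= \sum_(i <- r | P i) q (f i).
Proof.
elim/big_ind2 : _ => //; first by rewrite snorm0.
by move=> x a y b xa yb; rewrite (le_trans (snormD _ _)) // lerD.
Qed.

Lemma psumS c d z : psum c d.+1 z = psum c d z + z ^+ d *: c d.
Proof. by rewrite /psum big_ord_recr. Qed.

Lemma psumB c c' d z :
  psum c d z - psum c' d z = psum (fun k => c k - c' k) d z.
Proof. by rewrite /psum -sumrB; apply: eq_bigr => k _; rewrite scalerBr. Qed.

(** Cauchy's estimate for polynomials. The average of the values at the points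
    [t * w ^+ j], weighted by powers of a primitive root of unity [w] of order
    [d], isolates one coefficient; it plays the part of the Cauchy integral over
    the circle of radius [t]. *)
Lemma cauchy_psum c d (t M : R) k : 0 <= t -> (k < d)%N ->
  (forall z, rnorm z = t -> q (psum c d z) <= M) -> q (c k) * t ^+ k <= M.
Proof.
move=> t0 kd bM.
have d0 : (0 < d)%N by apply: leq_ltn_trans kd.
have [w pw w1] := @prim_root_complex R d d0.
have key : \sum_(j < d) w ^+ (j * (d - k)) *: psum c d (t%:C * w ^+ j) =
    d%:R *: (t%:C ^+ k *: c k).
  under eq_bigr do rewrite /psum scaler_sumr.
  rewrite exchange_big /= (bigD1 (Ordinal kd)) //= [X in _ + X]big1 ?addr0.
    rewrite [RHS]scaler_nat.
    under eq_bigr => j _.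
      rewrite scalerA exprMn mulrCA -exprM -exprD -mulnDr subnK; last first.
        exact: ltnW.
      rewrite mulnC exprM (prim_expr_order pw) expr1n mulr1; over.
    by rewrite sumr_const card_ord.
  move=> m /eqP mk.
  under eq_bigr => j _ do rewrite scalerA exprMn mulrCA -exprM -exprD -mulnDr
     mulnC exprM -scalerA.
  rewrite -scaler_sumr -scaler_suml.
  have -> : \sum_(i < d) (w ^+ (d - k + m)) ^+ i = 0; last first.
    by rewrite scale0r scaler0.
  (* A geometric sum, whose ratio differs from [1] since [d - k + m] is not a
     multiple of [d]. *)
  have : (w ^+ (d - k + m) - 1) * \sum_(i < d) (w ^+ (d - k + m)) ^+ i = 0.
    by rewrite -subrX1 -exprM mulnC exprM (prim_expr_order pw) expr1n subrr.
  move/eqP; rewrite mulf_eq0 => /orP[|/eqP//].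
  rewrite subr_eq0 -(prim_order_dvd pw) => /dvdnP[a E].
  exfalso; apply: mk; apply: val_inj => /=.
  have md := ltn_ord m.
  have : (d - k + m < 2 * d)%N.
    by rewrite mul2n -addnn -addnS leq_add // leq_subr.
  have : (0 < d - k + m)%N by rewrite addn_gt0 subn_gt0 kd.
  rewrite E muln_gt0 d0 andbT ltn_mul2r d0 /= => a0 a2.
  have a1 : a = 1%N by apply/eqP; rewrite eqn_leq a0 andbT -ltnS.
  move: E; rewrite a1 mul1n => E.
  by apply/eqP; rewrite -(eqn_add2l (d - k)) E subnK // ltnW.
have d0' : 0 < d%:R :> R by rewrite ltr0n.
rewrite -(ler_pM2l d0').
have -> : d%:R * (q (c k) * t ^+ k) = q (d%:R *: (t%:C ^+ k *: c k)).
  rewrite !snormZ rnorm_nat -rmorphXn /= rnorm_real ?exprn_ge0 //.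
  by rewrite [t ^+ k * _]mulrC.
rewrite -key (le_trans (snorm_sum _ _ _)) //.
apply: (@le_trans _ _ (\sum_(j < d) M)); last first.
  by rewrite sumr_const card_ord mulr_natl.
apply: ler_sum => j _; rewrite snormZ rnormX w1 expr1n mul1r bM //.
by rewrite rnormM rnorm_real // rnormX w1 expr1n mulr1.
Qed.

(** Comparison with a geometric series of ratio [u]. *)
Lemma psum_tail c z (u B : R) J d : (J <= d)%N -> 0 <= u -> u < 1 -> 0 <= B ->
  (forall k, (k < d)%N -> q (c k) * rnorm z ^+ k <= B * u ^+ k) ->
  q (psum c d z - psum c J z) <= B * u ^+ J / (1 - u).
Proof.
move=> Jd u0 u1 B0 cB.
have u1' : 0 < 1 - u by rewrite subr_gt0.
suff : q (psum c d z - psum c J z) * (1 - u) <= B * (u ^+ J - u ^+ d).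
  rewrite -ler_pdivlMr // => /le_trans; apply.
  rewrite ler_pM2r ?invr_gt0 // ler_wpM2l // gerBl.
  by rewrite exprn_ge0.
elim: d Jd cB => [|d IH].
  by rewrite leqn0 => /eqP-> _; rewrite !subrr snorm0 mul0r mulr0.
rewrite leq_eqVlt => /orP[/eqP<- _|].
  by rewrite !subrr snorm0 mul0r mulr0.
rewrite ltnS => Jd cB.
have {}IH := IH Jd (fun k kd => cB k (leq_trans kd (leqnSn d))).
rewrite psumS addrAC.
have h : q (psum c d z - psum c J z + z ^+ d *: c d) <=
         q (psum c d z - psum c J z) + B * u ^+ d.
  rewrite (le_trans (snormD _ _)) // lerD2l snormZ rnormX mulrC.
  exact: cB.
rewrite (le_trans (ler_wpM2r (ltW u1') h)) // mulrDl.
rewrite (le_trans (lerD IH (lexx _))) // exprS.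
by rewrite le_eqVlt; apply/orP; left; apply/eqP; ring.
Qed.

End Seminorm.
End PowerSeries.

(** * Convergent power series and their re-expansions *)

Section ConvergentSeries.
Set Implicit Arguments.
Unset Strict Implicit.
Context {R : realType} {F : lmodType R[i]}.
Implicit Types (z w b : R[i]) (c : nat -> F) (x y : F) (s t e : R).

Lemma geo_small (u C e : R) : 0 <= u -> u < 1 -> 0 < e ->
  \forall J \near \oo, C * u ^+ J <= e.
Proof.
move=> u0 u1 e0.
have h : (fun n => C * u ^+ n) @ \oo --> C * 0.
  by apply: cvgM; [exact: cvg_cst|apply: cvg_expr; rewrite ger0_norm].
rewrite mulr0 in h.
move/cvgr_dist_le : h => /(_ _ e0); apply: filterS => n.
by rewrite sub0r normrN; apply: le_trans; exact: ler_norm.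
Qed.

(** The coefficients at the centre [b] of the polynomial [psum c K]. *)
Definition shiftc c K b m : F := \sum_(k < K) (b ^+ (k - m) *+ 'C(k, m)) *: c k.

Lemma shiftc_ge c K b m : (K <= m)%N -> shiftc c K b m = 0.
Proof.
move=> Km; rewrite /shiftc big1 // => k _.
by rewrite bin_small ?mulr0n ?scale0r // (leq_trans (ltn_ord k)).
Qed.

Lemma psum_shiftc c K d b w : (K <= d)%N ->
  psum (shiftc c K b) d w = psum c K (b + w).
Proof.
move=> Kd; rewrite /psum /shiftc.
under eq_bigr => m _ do rewrite scaler_sumr.
rewrite exchange_big /=; apply: eq_bigr => k _.
rewrite exprDn scaler_suml.
rewrite (big_ord_widen d
  (fun m => (b ^+ (k - m) * w ^+ m *+ 'C(k, m)) *: c k)); last first.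
  exact: leq_trans (ltn_ord k) Kd.
rewrite [RHS]big_mkcond /=; apply: eq_bigr => m _.
case: ifPn => [_|]; first by rewrite scalerA -mulrnAl mulrC mulrnAl.
by rewrite -leqNgt => km; rewrite bin_small // mulr0n scale0r scaler0.
Qed.

(** As a function of the centre [b], the [m]-th coefficient is again a polynomial,
    namely the [m]-th derivative of [psum c K] divided by [m`!]. *)
Lemma shiftcE c K b m :
  shiftc c K b m = psum (fun i => 'C(i + m, m)%:R *: c (i + m)%N) (K - m) b.
Proof.
rewrite /shiftc /psum; case: (leqP K m) => Km.
  have /eqP-> : (K - m == 0)%N by [].
  by rewrite big_ord0; exact: (shiftc_ge c b Km).
rewrite -(big_mkord xpredT (fun k => (b ^+ (k - m) *+ 'C(k, m)) *: c k)).
rewrite (@big_cat_nat _ _ _ m) //=; last exact: ltnW.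
rewrite [X in X + _]big_nat_cond [X in X + _]big1 ?add0r; last first.
  by move=> k; rewrite andbT => /andP[_ km]; rewrite bin_small ?mulr0n ?scale0r.
rewrite -{1}[m]add0n big_addn big_mkord; apply: eq_bigr => k _.
by rewrite addnK scalerA mulr_natr.
Qed.

Section Seminorm.
Context {q : F -> R} (qS : seminorm q).

Lemma hassum_bounded c z y : hassum q c z y ->
  exists2 B, 0 <= B & forall k, q (c k) * rnorm z ^+ k <= B.
Proof.
move=> /(_ 1 ltr01)[D _ HD].
have S0 : 0 <= \sum_(k < D) q (c k) * rnorm z ^+ k.
  apply: sumr_ge0 => i _.
  by rewrite mulr_ge0 ?(snorm_ge0 qS) ?exprn_ge0 ?rnorm_ge0.
exists (2 + \sum_(k < D) q (c k) * rnorm z ^+ k); first by rewrite addr_ge0.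
move=> k; case: (ltnP k D) => kD.
  rewrite (bigD1 (Ordinal kD)) //= addrCA lerDl addr_ge0 // sumr_ge0 // => i _.
  by rewrite mulr_ge0 ?(snorm_ge0 qS) ?exprn_ge0 ?rnorm_ge0.
rewrite (le_trans _ (_ : 2 <= _)) ?lerDl //.
have -> : q (c k) * rnorm z ^+ k = q (psum c k.+1 z - psum c k z).
  by rewrite psumS addrC addKr (snormZ qS) rnormX mulrC.
rewrite (le_trans (snorm_tri qS y _ _)) // -[2]/(1 + 1) lerD //.
  by rewrite (snormBC qS) HD //= ltnW.
exact: HD.
Qed.

Lemma hassum_tail c z y (u B : R) J : 0 <= u -> u < 1 -> 0 <= B ->
  (forall k, q (c k) * rnorm z ^+ k <= B * u ^+ k) -> hassum q c z y ->
  q (y - psum c J z) <= B * u ^+ J / (1 - u).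
Proof.
move=> u0 u1 B0 cB cy; apply/ler_addgt0Pl => e e0.
have [D _ HD] := cy e e0.
rewrite (le_trans (snorm_tri qS (psum c (maxn D J) z) _ _)) // lerD //.
  by apply: HD; rewrite /= leq_maxl.
by apply: (psum_tail qS) => //; rewrite leq_maxr.
Qed.

Lemma ratio_bound c t s z : 0 < t -> rnorm z <= s ->
  forall B, (forall k, q (c k) * t ^+ k <= B) ->
  forall k, q (c k) * rnorm z ^+ k <= B * (s / t) ^+ k.
Proof.
move=> t0 zs B cB k.
rewrite (le_trans (_ : _ <= q (c k) * t ^+ k * (s / t) ^+ k)) //.
  rewrite -mulrA -exprMn [t * _]mulrC divfK ?gt_eqF //.
  rewrite ler_wpM2l ?(snorm_ge0 qS) // lerXn2r // ?nnegrE ?rnorm_ge0 //.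
  by rewrite (le_trans _ zs) ?rnorm_ge0.
rewrite ler_wpM2r // exprn_ge0 // divr_ge0 ?(ltW t0) //.
by rewrite (le_trans _ zs) ?rnorm_ge0.
Qed.

Section Sum.
Variables (c : nat -> F) (t : R) (g : R[i] -> F).
Hypothesis cg : forall z, rnorm z < t -> hassum q c z (g z).

Lemma hassum_bounded_at s : 0 <= s -> s < t ->
  exists2 B, 0 <= B & forall k, q (c k) * s ^+ k <= B.
Proof.
move=> s0 st; have [|B B0 cB] := @hassum_bounded c s%:C (g s%:C).
  by apply: cg; rewrite rnorm_real.
by exists B => // k; have := cB k; rewrite rnorm_real.
Qed.

Lemma hassum_uniform s e : 0 <= s -> s < t -> 0 < e ->
  \forall d \near \oo, forall z, rnorm z <= s -> q (g z - psum c d z) <= e.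
Proof.
move=> s0 st e0; pose s' := (s + t) / 2.
have [ss' s't] : s < s' /\ s' < t by rewrite /s'; lra.
have s'0 : 0 < s' by apply: le_lt_trans ss'.
have [B B0 cB] := hassum_bounded_at (ltW s'0) s't.
have u1 : s / s' < 1 by rewrite ltr_pdivrMr ?mul1r.
have u0 : 0 <= s / s' by rewrite divr_ge0 // ltW.
have := @geo_small (s / s') (B / (1 - s / s')) e u0 u1 e0.
apply: filterS => d de z zs.
apply: le_trans de; rewrite mulrAC.
apply: hassum_tail => //; last exact/cg/(le_lt_trans zs).
exact: ratio_bound.
Qed.

(** Cauchy's estimate passes to the limit of the partial sums. *)
Lemma cauchy_sum s M k : 0 <= s -> s < t ->
  (forall z, rnorm z = s -> q (g z) <= M) -> q (c k) * s ^+ k <= M.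
Proof.
move=> s0 st gM; apply/ler_addgt0Pl => e e0.
have [D _ HD] := hassum_uniform s0 st e0.
apply: (cauchy_psum qS (d := maxn D k.+1)) => //; first by rewrite leq_maxr.
move=> z zs; rewrite (le_trans (snorm_leD qS _ (g z))) // addrC lerD //.
  by rewrite (snormBC qS); apply: HD; rewrite /= ?leq_maxl // zs.
exact: gM.
Qed.

End Sum.

(** Cauchy's estimate for the difference of [g] and a partial sum, which is small
    near [b], uniformly in [b]; no double series has to be rearranged. *)
Lemma shiftc_approx c t g s eta e :
  (forall z, rnorm z < t -> hassum q c z (g z)) ->
  0 <= s -> 0 < eta -> s + eta < t -> 0 < e ->
  \forall K \near \oo, forall b c' eta', rnorm b <= s -> eta < eta' ->
    (forall w, rnorm w < eta' -> hassum q c' w (g (b + w))) ->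
    forall m, q (c' m - shiftc c K b m) * eta ^+ m <= e.
Proof.
move=> cg s0 eta0 set0 e0.
have := hassum_uniform cg (addr_ge0 s0 (ltW eta0)) set0 e0.
apply: filterS => K HK b c' eta' bs ee' c'g m.
pose h w := g (b + w) - psum c K (b + w).
have hh w : rnorm w < eta' ->
    hassum q (fun m => c' m - shiftc c K b m) w (h w).
  move=> /c'g c'w e' /c'w; apply: filterS2 (nbhs_infty_ge K) => d Kd.
  by rewrite -psumB psum_shiftc // /h opprB addrA subrK.
apply: (cauchy_sum hh) ee' _ => [|w wE]; first exact: ltW.
by apply: HK; rewrite (le_trans (rnormD _ _)) // wE lerD2r.
Qed.

(** Re-expansion at [b], where [c'] are the coefficients of [g] at [b]. It compares
    partial sums, so either series may be the one known to converge at [b + w]: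
    the disc of radius [rho] where [c] is known to represent [g] need not contain
    [b + w], a bound on [c] at the larger radius [sigma] is enough. The partial
    sums of [c], re-expanded at [b], are then bounded on a circle around [b], so
    that their tails are uniformly small, and their coefficients tend to [c']. *)
Lemma psum_recenter c c' rho eta sigma B b w g :
  0 < eta -> rnorm b < rho -> rnorm b + rnorm w < sigma ->
  (forall z, rnorm z < rho -> hassum q c z (g z)) ->
  (forall w, rnorm w < eta -> hassum q c' w (g (b + w))) ->
  (forall k, q (c k) * sigma ^+ k <= B) ->
  forall e, 0 < e ->
  \forall K \near \oo, q (psum c K (b + w) - psum c' K w) <= e.
Proof.
move=> eta0 brho bws cg c'g cB e e0.
have b0 := rnorm_ge0 b; have w0 := rnorm_ge0 w.
have B0 : 0 <= B.
  by apply: le_trans (cB 0%N); rewrite expr0 mulr1 (snorm_ge0 qS).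
(* A circle around [b] through points beyond [b + w] but inside the disc of
   radius [sigma], on which the partial sums are bounded by [B1]. *)
pose s1 := (rnorm w + (sigma - rnorm b)) / 2.
have [ws1 s1s] : rnorm w < s1 /\ rnorm b + s1 < sigma by rewrite /s1; lra.
have s10 : 0 < s1 by apply: le_lt_trans ws1.
have sigma0 : 0 < sigma by lra.
pose u0 := (rnorm b + s1) / sigma.
have u00 : 0 <= u0 by rewrite divr_ge0 ?addr_ge0 // ltW.
have u01 : u0 < 1 by rewrite ltr_pdivrMr ?mul1r.
pose B1 := B / (1 - u0).
have B10 : 0 <= B1 by rewrite divr_ge0 // subr_ge0 ltW.
have shB K m : q (shiftc c K b m) * s1 ^+ m <= B1.
  case: (leqP K m) => Km.
    by rewrite shiftc_ge // (snorm0 qS) mul0r.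
  apply: (cauchy_psum qS (d := K)) => // [|v vs1]; first exact: ltW.
  rewrite psum_shiftc // -[psum _ _ _]subr0 -(_ : psum c 0 (b + v) = 0).
    rewrite (le_trans (psum_tail qS (u := u0) (B := B) _ _ _ _ _)) //
      ?expr0 ?mulr1 //.
    move=> k _; apply: ratio_bound => //.
    by rewrite (le_trans (rnormD _ _)) // vs1.
  by rewrite /psum big_ord0.
pose e1 := Num.min eta (rho - rnorm b) / 2.
have e1P : 0 < e1 /\ e1 < eta /\ rnorm b + e1 < rho.
  have m0 : 0 < Num.min eta (rho - rnorm b) by rewrite lt_min eta0 subr_gt0.
  have m1 : Num.min eta (rho - rnorm b) <= eta by rewrite ge_min lexx.
  have m2 : Num.min eta (rho - rnorm b) <= rho - rnorm b.
    by rewrite ge_min lexx orbT.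
  by rewrite /e1; split; [lra|split; lra].
have [e10 [e1e be1]] := e1P.
have approx m e' : 0 < e' ->
    \forall K \near \oo, q (c' m - shiftc c K b m) <= e'.
  move=> e'0; have e'1 : 0 < e' * e1 ^+ m by rewrite mulr_gt0 // exprn_gt0.
  have := shiftc_approx cg b0 e10 be1 e'1.
  apply: filterS => K /(_ b c' eta (lexx _) e1e c'g m).
  by rewrite ler_pM2r // exprn_gt0.
have c'B m : q (c' m) * s1 ^+ m <= B1.
  rewrite -ler_pdivlMr ?exprn_gt0 //; apply/ler_addgt0Pl => e' e'0.
  have [K _ HK] := approx m e' e'0.
  rewrite (le_trans (snorm_leD qS _ (shiftc c K b m))) // addrC lerD //.
    by apply: HK => /=.
  by rewrite ler_pdivlMr ?exprn_gt0.
pose u := rnorm w / s1.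
have u00' : 0 <= u by rewrite divr_ge0 // ltW.
have u1 : u < 1 by rewrite ltr_pdivrMr ?mul1r.
have e30 : 0 < e / 3 by lra.
(* Cut both re-expansions at the index [J], chosen so that both tails are at most
   [e / 3]; finitely many coefficients remain to be compared. *)
have [J _ /(_ J (leqnn J)) /= HJ] := geo_small (B1 / (1 - u)) u00' u1 e30.
rewrite mulrAC in HJ.
have small : \forall K \near \oo,
    q (psum (shiftc c K b) J w - psum c' J w) <= e / 3.
  pose D := (\sum_(m < J) rnorm w ^+ m) + 1.
  have D0 : 0 < D.
    by rewrite ltr_wpDl // sumr_ge0 // => i _; rewrite exprn_ge0.
  have : \forall K \near \oo, forall m, (m < J)%N ->
      q (c' m - shiftc c K b m) <= e / 3 / D.
    elim: (J) => [|n IH]; first by near=> K.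
    have := approx n (e / 3 / D) (divr_gt0 e30 D0).
    apply: filterS2 IH => K IH Hn m; rewrite ltnS leq_eqVlt => /orP[/eqP->//|].
    exact: IH.
  apply: filterS => K HK; rewrite psumB (le_trans (snorm_sum qS _ _ _)) //.
  rewrite (@le_trans _ _ (\sum_(m < J) rnorm w ^+ m * (e / 3 / D))) //.
    apply: ler_sum => m _; rewrite (snormZ qS) rnormX ler_wpM2l ?exprn_ge0 //.
    by rewrite (snormBC qS) HK.
  rewrite -mulr_suml mulrCA ler_piMr ?(ltW e30) // ler_pdivrMr // mul1r.
  by rewrite /D lerDl.
apply: filterS2 (nbhs_infty_ge J) small => K JK small.
rewrite (le_trans (snorm_tri qS (psum (shiftc c K b) J w) _ _)) //.
have t1 : q (psum c K (b + w) - psum (shiftc c K b) J w) <= e / 3.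
  apply: le_trans HJ; rewrite -(psum_shiftc _ _ _ (leqnn K)).
  apply: (psum_tail qS) => // k _.
  by apply: ratio_bound => //; exact: shB.
have t2 : q (psum c' K w - psum c' J w) <= e / 3.
  apply: le_trans HJ; apply: (psum_tail qS) => // k _.
  by apply: ratio_bound => //; exact: c'B.
have t3 := snorm_tri qS (psum c' J w) (psum (shiftc c K b) J w) (psum c' K w).
rewrite (snormBC qS (psum c' J w)) in t3; lra.
Unshelve. all: by end_near. Qed.

End Seminorm.
End ConvergentSeries.

(** * Convergence on the maximal disc *)

Section MaximalDisc.
Context {R : realType} {F : lmodType R[i]}.
Set Implicit Arguments.
Unset Strict Implicit.
Implicit Types (z w b : R[i]) (c : nat -> F) (x y : F) (s t e rho delta : R).

Lemma geo_half_sum n : \sum_(m < n) (2^-1 : R) ^+ m <= 2.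
Proof.
suff -> : \sum_(m < n) (2^-1 : R) ^+ m = 2 - 2 * 2^-1 ^+ n.
  by rewrite gerBl mulr_ge0 ?exprn_ge0 ?invr_ge0.
elim: n => [|n IH]; first by rewrite big_ord0 expr0; ring.
by rewrite big_ord_recr /= IH exprS; field.
Qed.

Context {q : F -> R} (qS : seminorm q).

(** An argument of Weierstrass. Cauchy's estimates at all centres [b] of modulus
    [s] bound the derivatives of the series on this circle; Cauchy's estimate for
    the [m]-th derivative, whose coefficients are [c k] times ['C(k, m)], then
    bounds [c k]. *)
Lemma weierstrass_binomial c g rho delta M s delta' k m :
  (forall z, rnorm z < rho -> hassum q c z (g z)) ->
  (forall b, rnorm b < rho -> exists c', forall w, rnorm w < delta ->
     hassum q c' w (g (b + w))) ->
  (forall z, rnorm z < rho + delta -> q (g z) <= M) ->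
  0 <= s -> s < rho -> 0 < delta' -> delta' < delta -> (m <= k)%N ->
  q (c k) * (s ^+ (k - m) * delta' ^+ m *+ 'C(k, m)) <= M.
Proof.
move=> cg loc gM s0 srho d'0 d'd mk.
pose eta := Num.min delta (rho - s) / 2.
have [eta0 [etad etas]] : 0 < eta /\ eta < delta /\ s + eta < rho.
  have m0 : 0 < Num.min delta (rho - s).
    by rewrite lt_min subr_gt0 srho (lt_trans d'0 d'd).
  have m1 : Num.min delta (rho - s) <= delta by rewrite ge_min lexx.
  have m2 : Num.min delta (rho - s) <= rho - s by rewrite ge_min lexx orbT.
  by rewrite /eta; split; [lra|split; lra].
have main e : 0 < e ->
    q (c k) * s ^+ (k - m) *+ 'C(k, m) <= M / delta' ^+ m + e.
  move=> e0; have e1 : 0 < e * eta ^+ m by rewrite mulr_gt0 // exprn_gt0.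
  have [K0 _ HK] := shiftc_approx qS cg s0 eta0 etas e1.
  pose K := maxn K0 k.+1.
  have kK : (k < K)%N by rewrite /K leq_maxr.
  have bd b : rnorm b = s -> q (shiftc c K b m) <= M / delta' ^+ m + e.
    move=> bs; have brho : rnorm b < rho by rewrite bs.
    have [c' c'g] := loc b brho.
    have := HK K (leq_maxl _ _) b c' delta _ etad c'g m.
    rewrite bs lexx ler_pM2r ?exprn_gt0 // => /(_ isT) cc.
    rewrite (le_trans (snorm_leD qS _ (c' m))) // lerD // 1?(snormBC qS) //.
    rewrite ler_pdivlMr ?exprn_gt0 //.
    apply: (cauchy_sum qS c'g) => // [|w wd]; first exact: ltW.
    apply: gM; rewrite (le_lt_trans (rnormD _ _)) // bs wd.
    by rewrite ltrD.
  have := @cauchy_psum _ _ q qS (fun i => 'C(i + m, m)%:R *: c (i + m)%N)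
    (K - m) s (M / delta' ^+ m + e) (k - m) s0.
  rewrite subnK // (snormZ qS) rnorm_nat => h.
  rewrite -mulr_natl mulrA; apply: h.
    by rewrite ltn_sub2r // (leq_ltn_trans mk).
  by move=> z zs; rewrite -shiftcE bd.
rewrite mulrnAr mulrA -mulrnAl -ler_pdivlMr ?exprn_gt0 //.
by apply/ler_addgt0Pl => e /main; rewrite addrC.
Qed.

(** Summing over [m] with the binomial formula: if the expansions of [g] at all
    points of the disc of radius [rho] converge at distance less than [delta],
    then the coefficients at [0] are bounded at radii exceeding [rho], as one
    sees by taking [s] close to [rho]. *)
Lemma weierstrass_bound c g rho delta M s delta' k :
  (forall z, rnorm z < rho -> hassum q c z (g z)) ->
  (forall b, rnorm b < rho -> exists c', forall w, rnorm w < delta ->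
     hassum q c' w (g (b + w))) ->
  (forall z, rnorm z < rho + delta -> q (g z) <= M) ->
  0 <= s -> s < rho -> 0 < delta' -> delta' < delta ->
  q (c k) * (s + delta' / 2) ^+ k <= M * 2.
Proof.
move=> cg loc gM s0 srho d'0 d'd.
have M0 : 0 <= M.
  have z0 : rnorm (0 : R[i]) < rho + delta by rewrite rnorm0; lra.
  by apply: le_trans (gM _ z0); exact: snorm_ge0 qS _.
rewrite exprDn mulr_sumr.
apply: (@le_trans _ _ (\sum_(m < k.+1) M * 2^-1 ^+ m)); last first.
  by rewrite -mulr_sumr ler_wpM2l // geo_half_sum.
apply: ler_sum => m _; rewrite exprMn mulrA -mulrnAl mulrA.
rewrite ler_wpM2r ?exprn_ge0 ?invr_ge0 //.
by apply: (weierstrass_binomial cg loc gM) => //; exact: leq_ord.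
Qed.

(** The disc is contained in a square, which is compact as a product of segments,
    so a common [d] exists by the covering property of compact sets. *)
Lemma closed_disc_cover (P : R -> R[i] -> Prop) (a : R) :
  (forall z, exists2 eps : R, 0 < eps &
    forall z' (d : R), rnorm (z' - z) < eps -> 0 < d -> d < eps -> P d z') ->
  exists2 d : R, 0 < d & forall z, rnorm z <= a -> P d z.
Proof.
move=> loc.
have cpt : compact (`[- a, a]%classic `*` `[- a, a]%classic : set (R * R)).
  by apply: compact_setX; exact: segment_compact.
move/compact_near_coveringP : cpt
  => /(_ R (0^'+) (fun d xy => P d (xy.1 +i* xy.2)) _) [].
  move=> [x y] _.
  have [eps eps0 He] := loc (x +i* y).
  have e2 : 0 < eps / 2 by lra.
  exists (ball (x, y) (eps / 2), [set d | 0 < d < eps]).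
    split => /=; first exact: nbhsx_ballx.
    near=> d; apply/andP; split; near: d.
      exact: nbhs_right_gt.
    exact: nbhs_right_lt.
  move=> [[x' y'] d] /= [[bx by'] /andP[d0 de]].
  apply: He => //.
  move: bx by'; rewrite /ball /= (distrC x) (distrC y) => bx by'.
  rewrite (_ : _ - _ = (x' - x) +i* (y' - y)); last by simpc.
  by rewrite (le_lt_trans (rnorm_le_ReIm _)) //=; lra.
move=> d0 /= d00 Hd; have d02 : 0 < d0 / 2 by move: d00 => /=; lra.
exists (d0 / 2) => //.
move=> [x y] za; apply: (Hd (d0 / 2) _ d02 (x, y)).
  by rewrite /ball_ /= sub0r normrN gtr0_norm //; move: d00 => /=; lra.
split; rewrite /= in_itv /= -ler_norml (le_trans _ za) //.
  exact: (ler_Re_rnorm (x +i* y)).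
exact: (ler_Im_rnorm (x +i* y)).
Unshelve. all: by end_near. Qed.

Lemma hassum_eq c z c' w y :
  (forall e, 0 < e -> \forall K \near \oo, q (psum c K z - psum c' K w) <= e) ->
  hassum q c z y -> hassum q c' w y.
Proof.
move=> cc cy e e0; have e2 : 0 < e / 2 by lra.
apply: filterS2 (cc _ e2) (cy _ e2) => K h1 h2.
rewrite (le_trans (snorm_tri qS (psum c K z) _ _)) //; lra.
Qed.

(** Suppose that the series at [0] represents [g] on a maximal disc of radius
    [rho < T] only. By compactness the expansions at the points of the closed disc
    converge on discs of a common radius, so that by Weierstrass the coefficients
    at [0] are bounded at a radius larger than [rho]. Comparing with the
    expansions at points [b] close to the circle of radius [rho] shows that the
    series at [0] still represents [g] beyond this circle. *)
Lemma hassum_maximal_disc (c : R[i] -> nat -> F) g (T M : R) :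
  (forall b, rnorm b < T -> exists2 d : R, 0 < d &
     forall w, rnorm w < d -> hassum q (c b) w (g (b + w))) ->
  (forall z, rnorm z < T -> q (g z) <= M) ->
  forall z, rnorm z < T -> hassum q (c 0) z (g z).
Proof.
move=> loc gM z zT.
have T0 : 0 < T by apply: le_lt_trans zT; exact: rnorm_ge0.
pose S := [set t : R | [/\ 0 < t, t <= T &
  forall z, rnorm z < t -> hassum q (c 0) z (g z)]].
have [|d d0 Hd] := loc 0; first by rewrite rnorm0.
have S0 : S !=set0.
  exists (Num.min d T); split; first by rewrite lt_min d0.
    by rewrite ge_min lexx orbT.
  by move=> v; rewrite lt_min => /andP[vd _]; have := Hd v vd; rewrite add0r.
have ST : ubound S T by move=> t [].
have hS : has_sup S by split => //; exists T.
pose rho := sup S.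
have cg v : rnorm v < rho -> hassum q (c 0) v (g v).
  by move=> /(sup_gt S0)[t [_ _ ct] vt]; exact: ct.
have [Trho|rhoT] := leP T rho; first by apply/cg/(lt_le_trans zT).
exfalso.
have [t0 St0] := S0.
have rho0 : 0 < rho.
  by apply: (@lt_le_trans _ _ t0); [case: St0|exact: sup_upper_bound].
have unif : exists2 d : R, 0 < d & forall b, rnorm b <= rho -> rnorm b <= rho ->
    forall w, rnorm w < d -> hassum q (c b) w (g (b + w)).
  apply: closed_disc_cover => b.
  have [brho|rhob] := leP (rnorm b) rho; last first.
    exists (rnorm b - rho) => [|b' d' bb' _ _ b'rho]; first by rewrite subr_gt0.
    have := rnormD (b - b') b'; rewrite subrK rnormB; lra.
  have [|d1 d10 H1] := loc b; first exact: le_lt_trans brho rhoT.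
  exists (d1 / 2) => [|b' d' bb' d'0 d'd b'rho w wd]; first by lra.
  have [|eta eta0 Heta] := loc b'; first exact: le_lt_trans b'rho rhoT.
  have sd : (rnorm (b' - b) + rnorm w + d1) / 2 < d1 by lra.
  have b'b0 := rnorm_ge0 (b' - b); have w0 := rnorm_ge0 w.
  have s0 : 0 <= (rnorm (b' - b) + rnorm w + d1) / 2 by lra.
  have [B B0 cB] := hassum_bounded_at qS H1 s0 sd.
  apply: (@hassum_eq (c b) ((b' - b) + w)) => [e e0|]; last first.
    rewrite -(_ : b + (b' - b + w) = b' + w); last by rewrite addrA subrKC.
    by apply: H1; rewrite (le_lt_trans (rnormD _ _)) //; lra.
  apply: (psum_recenter qS eta0 _ _ H1 _ _ e0).
  - lra.
  - by instantiate (1 := (rnorm (b' - b) + rnorm w + d1) / 2); lra.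
  - by move=> v vd; rewrite addrA subrKC; apply: Heta.
  - exact: cB.
have [d1 d10 H1] := unif.
pose dl := Num.min d1 (Num.min (T - rho) rho).
have dl0 : 0 < dl by rewrite !lt_min d10 subr_gt0 rhoT rho0.
have dl1 : dl <= d1 by rewrite ge_min lexx.
have dlT : dl <= T - rho by rewrite !ge_min lexx orbT.
have dlr : dl <= rho by rewrite !ge_min lexx !orbT.
have loc' b : rnorm b < rho -> exists c', forall w, rnorm w < dl ->
    hassum q c' w (g (b + w)).
  move=> /ltW brho; exists (c b) => w wd; apply: H1 => //.
  exact: lt_le_trans wd dl1.
have gM' v : rnorm v < rho + dl -> q (g v) <= M.
  by move=> vd; apply: gM; lra.
(* The bound of Weierstrass for the radii [rho - dl / 8] and [dl / 2]. *)
have cB k : q (c 0 k) * (rho + dl / 8) ^+ k <= M * 2.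
  rewrite (_ : rho + dl / 8 = (rho - dl / 8) + (dl / 2) / 2); last by field.
  by apply: (@weierstrass_bound _ _ _ _ _ (rho - dl / 8) (dl / 2) _
    cg loc' gM'); lra.
suff : S (rho + dl / 16) by move/(sup_upper_bound hS); rewrite -/rho; lra.
split; [lra|lra|move=> v vd].
have [vrho|rhov] := ltP (rnorm v) rho; first exact: cg.
have v0 : 0 < rnorm v by lra.
(* [b] is the point of modulus [rho - dl / 16] on the segment from [0] to [v]. *)
pose l := (rho - dl / 16) / rnorm v.
have l0 : 0 <= l by rewrite divr_ge0 //; lra.
have l1 : l <= 1 by rewrite ler_pdivrMr // mul1r; lra.
pose b := l%:C * v; pose w := v - b.
have bE : rnorm b = rho - dl / 16.
  by rewrite rnormM rnorm_real // divfK // gt_eqF.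
have wE : rnorm w = rnorm v - (rho - dl / 16).
  have -> : w = (1 - l)%:C * v by rewrite rmorphB rmorph1 mulrBl mul1r.
  by rewrite rnormM rnorm_real ?subr_ge0 // mulrBl mul1r divfK // gt_eqF.
have wd1 : rnorm w < d1 by rewrite wE; lra.
have bl : rnorm b <= rho by rewrite bE; lra.
rewrite -(_ : b + w = v); last by rewrite subrKC.
apply: (@hassum_eq (c b) w) (H1 b bl bl w wd1) => e e0.
have := psum_recenter qS d10 _ _ cg (H1 b bl bl) cB e0.
move=> /(_ w); rewrite bE wE => h.
have {}h := h _ _; apply: filterS (h _ _) => [K| |]; [|lra|lra].
by rewrite (snormBC qS).
Qed.

End MaximalDisc.

(** * Linear complements *)

Section Complement.
Set Implicit Arguments.
Unset Strict Implicit.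

Definition subspace {K : fieldType} {V : lmodType K} (A : set V) : Prop :=
  A 0 /\ forall (a : K) x y, A x -> A y -> A (a *: x + y).

(** The projection along [N] onto an algebraic complement of [N], which Zorn's
    lemma provides as a maximal subspace meeting [N] trivially. *)
Lemma exists_projection {K : fieldType} {V : lmodType K} (N : set V) :
  subspace N ->
  exists2 p : V -> V, linear p &
    (forall x, N (p x - x)) /\ (forall x, N x -> p x = 0).
Proof.
move=> [N0 NL].
have NN x : N x -> N (- x).
  by move=> Nx; rewrite -[- x]addr0 -scaleN1r; exact: NL.
have NZ a x : N x -> N (a *: x).
  by move=> Nx; rewrite -[_ *: _]addr0; exact: NL.
have ND x y : N x -> N y -> N (x + y).
  by move=> Nx Ny; rewrite -[x]scale1r; exact: NL.
pose P (D : set V) := (forall a x y, D x -> D y -> D (a *: x + y)) /\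
  (forall x, D x -> N x -> x = 0).
have [G GP Gtot|A [[AL AN] Amax]] := @Zorn_bigcup V P.
  split=> [a x y [X GX Xx] [Y GY Yy]|x [X GX Xx]]; last exact: (GP X GX).2.
  have [XY|YX] := Gtot X Y GX GY.
    by exists Y => //; apply: (GP Y GY).1 => //; exact: XY.
  by exists X => //; apply: (GP X GX).1 => //; exact: YX.
(* The condition [P] also holds for the empty set, so [0] is added. *)
pose A1 : set V := [set x | A x \/ x = 0].
have A1L a x y : A1 x -> A1 y -> A1 (a *: x + y).
  move=> [Ax|->] [Ay|->]; rewrite ?scaler0 ?add0r ?addr0.
  - by left; exact: AL.
  - left; rewrite -[_ *: _]addr0; apply: (AL) => //.
    by have := AL (-1) x x Ax Ax; rewrite scaleN1r addNr.
  - by left.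
  - by right.
have A1N x : A1 x -> N x -> x = 0 by move=> [Ax|//]; exact: AN.
have ex x : exists m, A1 m /\ N (m - x).
  apply: contrapT => no.
  have noA m : A1 m -> ~ N (m - x) by move=> Am Nm; apply: no; exists m.
  pose B : set V := [set v | exists a m, A1 m /\ v = a *: x + m].
  apply: (Amax B).
    split=> [v Av|BA].
      by exists 0, v; split; [left|rewrite scale0r add0r].
    have /BA Ax : B x by exists 1, 0; split; [right|rewrite scale1r addr0].
    by apply: (noA x); [left|rewrite subrr].
  split=> [a _ _ [b [m [Am ->]]] [b' [m' [Am' ->]]]|_ [a [m [Am ->]]] Nv].
    exists (a * b + b'), (a *: m + m'); split; first exact: A1L.
    by rewrite scalerDr scalerDl scalerA addrACA.
  have [a0|a0] := eqVneq a 0.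
    by move: Nv; rewrite a0 scale0r add0r; exact: A1N.
  exfalso; apply: (noA (- a^-1 *: m)).
    by rewrite -[_ *: m]addr0; apply: A1L => //; right.
  rewrite (_ : _ - x = - a^-1 *: (a *: x + m)); first exact: NZ.
  by rewrite scalerDr scalerA mulNr mulVf // scaleN1r addrC.
have [p /all_and2[pA pN]] := choice ex.
exists p; last first.
  split=> [//|x Nx]; apply: A1N => //.
  by rewrite -(subrK x (p x)); exact: ND.
move=> a x y; apply/eqP; rewrite -subr_eq0; apply/eqP; apply: A1N.
  rewrite [X in A1 X]addrC -(scaleN1r (_ + _)).
  by apply: (A1L) => //; apply: (A1L).
rewrite (_ : _ - _ = (p (a *: x + y) - (a *: x + y)) -
  (a *: (p x - x) + (p y - y))); first by apply: ND => //; apply: NN; exact: NL.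
by rewrite scalerBr [in RHS]addrACA -opprD opprB [in RHS]addrA subrK.
Qed.
End Complement.

(** * Continuous seminorms of a locally convex space *)

Section Convexity.
Set Implicit Arguments.
Unset Strict Implicit.
Context {R : realType} {V : lmodType R[i]}.

Lemma convex_setRP (W : set V) : convex_set W <->
  forall x y (s t : R), 0 <= s -> 0 <= t -> s + t = 1 -> W x -> W y ->
    W (s%:C *: x + t%:C *: y).
Proof.
split=> [cW x y s t s0 t0 st Wx Wy|cW x y l].
  have s0' : 0 <= s%:C by rewrite ler0c.
  have s1' : s%:C <= 1 by rewrite -(rmorph1 (real_complex R)) lecR -st lerDl.
  have := cW x y (Itv01 s0' s1') (mem_set Wx) (mem_set Wy).
  rewrite inE /conv /= /unstable.onem => /=.
  by rewrite -(rmorph1 (real_complex R)) -rmorphB -st addrAC subrr add0r.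
rewrite !inE => Wx Wy.
have l0 : 0 <= (l%:num : R[i]) by [].
have l1 : (l%:num : R[i]) <= 1 by [].
have lE : (complex.Re l%:num)%:C = l%:num :> R[i].
  by rewrite RRe_real // ger0_real.
move: l0 l1; rewrite -lE ler0c -(rmorph1 (real_complex R)) lecR => l0 l1.
have := cW x y _ (1 - complex.Re l%:num) l0 _ _ Wx Wy.
rewrite subr_ge0 addrCA subrr addr0 => /(_ l1 erefl).
have -> : (1 - complex.Re l%:num)%:C = 1 - l%:num :> R[i].
  by rewrite -[in RHS]lE [LHS]rmorphB rmorph1.
by rewrite lE.
Qed.
End Convexity.

Section ContinuousSeminorms.
Set Implicit Arguments.
Unset Strict Implicit.
Context {R : realType} {F : tvsType R[i]}.
Implicit Types (x y : F) (A V : set F) (q : F -> R).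

Lemma nbhs_translate x A : nbhs 0 A -> nbhs x [set y | A (y - x)].
Proof.
have := @add_continuous F (x, - x); rewrite /continuous_at /= subrr => h.
by move=> /h[[B1 B2] /= [Bx Bmx] BA]; apply: filterS Bx => y By;
  apply: (BA (y, - x)); split=> //=; exact: (nbhs_singleton Bmx).
Qed.

Lemma nbhs_translate0 x A : nbhs x A -> nbhs 0 [set h | A (x + h)].
Proof.
have := @add_continuous F (x, 0); rewrite /continuous_at /= addr0 => h.
by move=> /h[[B1 B2] /= [Bx B0] BA]; apply: filterS B0 => y By;
  apply: (BA (x, y)); split=> //=; exact: (nbhs_singleton Bx).
Qed.

Lemma nbhs0_scale (a : R[i]) A : nbhs 0 A -> nbhs 0 [set x : F | A (a *: x)].
Proof.
have := @scale_continuous _ F (a, 0); rewrite /continuous_at /= scaler0 => h.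
by move=> /h[[B1 B2] /= [Ba B0] BA]; apply: filterS B0 => y By;
  apply: (BA (a, y)); split=> //=; exact: (nbhs_singleton Ba).
Qed.

Lemma nbhs0_scale_small x A : nbhs 0 A -> exists2 d : R, 0 < d &
  \forall y \near x, forall a : R[i], rnorm a < d -> A (a *: y).
Proof.
have := @scale_continuous _ F (0, x); rewrite /continuous_at /= scale0r => h.
move=> /h[[B1 B2] /= [[e e0 Be] Bx] BA].
exists (complex.Re e); first by move: e0; rewrite /= ltcE => /andP[].
apply: filterS Bx => y By a ad; apply: (BA (a, y)); split => //=.
apply: Be; rewrite /ball_ /= sub0r normrN rnormE.
have -> : e = (complex.Re e)%:C by rewrite RRe_real // ger0_real // ltW.
by rewrite ltcR.
Qed.

Definition cseminorm q : Prop := seminorm q /\ nbhs 0 [set x : F | q x < 1].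

(** The seminorm is the gauge of the set [B] of those [x] all of whose multiples
    by scalars of the unit disc lie in a convex neighbourhood [W] inside [V]: this
    set is convex and balanced, and it is a neighbourhood of [0] since the
    multiplication by scalars is jointly continuous. *)
Lemma exists_cseminorm V : nbhs 0 V ->
  exists2 q, cseminorm q & forall x, q x < 1 -> V x.
Proof.
move=> V0.
have [W [Wcv W0 WV]] : exists W : set F, [/\ convex_set W, nbhs 0 W & W `<=` V].
  have [BB Bcv [Bo Bnb]] := @locally_convex R[i] F.
  have [W [BW W0] WV] := Bnb 0 V V0.
  exists W; split => //; first by apply: Bcv; rewrite inE.
  by apply: open_nbhs_nbhs; split => //; exact: Bo.
move/convex_setRP : Wcv => Wcv.
pose B : set F := [set x | forall a : R[i], rnorm a <= 1 -> W (a *: x)].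
have Bcv x y (s t : R) : 0 <= s -> 0 <= t -> s + t = 1 -> B x -> B y ->
    B (s%:C *: x + t%:C *: y).
  move=> s0 t0 st Bx By a a1; rewrite scalerDr !scalerA ![a * _]mulrC -!scalerA.
  by apply: Wcv => //; [exact: Bx|exact: By].
have Bbal a x : rnorm a <= 1 -> B x -> B (a *: x).
  move=> a1 Bx b b1; rewrite scalerA; apply: Bx; rewrite rnormM.
  by rewrite mulr_ile1 ?rnorm_ge0.
have B0 : nbhs 0 B.
  have [d d0 Hd] := nbhs0_scale_small 0 W0.
  have d2 : 0 < d / 2 by lra.
  apply: filterS (nbhs0_scale (d / 2)^-1%:C Hd) => x Hx a a1.
  have := Hx (a * (d / 2)%:C) => /=.
  rewrite scalerA -mulrA -rmorphM divff ?gt_eqF // rmorph1 mulr1; apply.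
  rewrite rnormM rnorm_real ?(ltW d2) //.
  by have := ler_wpM2r (ltW d2) a1; rewrite mul1r; lra.
pose S x := [set t : R | 0 < t /\ B (t^-1%:C *: x)].
pose q x : R := inf (S x).
have Sneq x : S x !=set0.
  have [d d0 Hd] := nbhs0_scale_small x B0.
  have d2 : 0 < d / 2 by lra.
  exists (d / 2)^-1; split; first by rewrite invr_gt0.
  rewrite invrK; apply: (nbhs_singleton Hd).
  by rewrite rnorm_real ?(ltW d2) //; lra.
have Slb x : lbound (S x) 0 by move=> t [/ltW].
have Sinf x : has_inf (S x) by split => //; exists 0.
have q0 x : 0 <= q x by exact: lb_le_inf.
have qlt x t : q x < t -> 0 < t /\ B (t^-1%:C *: x).
  move=> qxt; have t0 : 0 < t by apply: le_lt_trans qxt.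
  split => //.
  have [t' [t'0 Bt'] t't] := inf_lt (Sneq x) qxt.
  have -> : t^-1%:C *: x = (t' / t)%:C *: (t'^-1%:C *: x).
    by rewrite scalerA -rmorphM mulrAC divff ?gt_eqF // mul1r.
  apply: Bbal => //; rewrite rnorm_real; last by rewrite divr_ge0 // ltW.
  by rewrite ler_pdivrMr // mul1r; exact: ltW.
have qle x t : 0 < t -> B (t^-1%:C *: x) -> q x <= t.
  by move=> t0 Bt; apply: ge_inf; [exists 0|split].
exists q; last first.
  move=> x /qlt [_]; rewrite invr1 rmorph1 scale1r => /(_ 1).
  by rewrite rnorm1 lexx scale1r => /(_ isT) /WV.
split; first split.
- move=> x y; apply/ler_addgt0Pl => e e0.
  have e2 : 0 < e / 2 by lra.
  have [s0 Bs] := @qlt x (q x + e / 2) ltac:(lra).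
  have [t0 Bt] := @qlt y (q y + e / 2) ltac:(lra).
  set s := q x + _ in s0 Bs; set t := q y + _ in t0 Bt.
  have st0 : 0 < s + t by lra.
  have -> : e + (q x + q y) = s + t by rewrite /s /t; field.
  apply: qle => //.
  have := Bcv _ _ (s / (s + t)) (t / (s + t)) _ _ _ Bs Bt.
  rewrite !divr_ge0 ?ltW // -mulrDl divff ?gt_eqF // => /(_ isT isT erefl).
  rewrite !scalerA -!rmorphM ![_ / (s + t)]mulrC -!mulrA.
  rewrite !divff ?gt_eqF // mulr1.
  by rewrite -scalerDr.
- have main (a : R[i]) x : a != 0 -> q (a *: x) <= rnorm a * q x.
    move=> a0; have na0 : 0 < rnorm a by rewrite rnorm_gt0.
    rewrite -ler_pdivrMl //; apply/ler_addgt0Pl => e e0.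
    have [s0 Bs] := @qlt x (q x + e) ltac:(lra).
    rewrite [e + _]addrC ler_pdivrMl //.
    apply: qle; first by rewrite mulr_gt0.
    have -> : (rnorm a * (q x + e))^-1%:C *: (a *: x) =
        ((rnorm a)^-1%:C * a) *: ((q x + e)^-1%:C *: x).
      by rewrite !scalerA invfM rmorphM /= mulrAC.
    apply: Bbal => //; rewrite rnormM rnorm_real ?invr_ge0 ?(ltW na0) //.
    by rewrite mulVf // gt_eqF.
  move=> a x; have [->|a0] := eqVneq a 0.
    rewrite scale0r rnorm0 mul0r; apply/eqP; rewrite eq_le q0 andbT.
    apply/ler_addgt0Pl => e e0; rewrite addr0; apply: qle => //.
    by rewrite scaler0; exact: nbhs_singleton B0.
  have na0 : 0 < rnorm a by rewrite rnorm_gt0.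
  apply/eqP; rewrite eq_le main //=.
  have := main a^-1 (a *: x) (invr_neq0 a0).
  by rewrite scalerA mulVf // scale1r rnormV ler_pdivlMl.
- apply: filterS (nbhs0_scale 2%:C B0) => x Bx /=.
  apply: (@le_lt_trans _ _ 2^-1); last by lra.
  by apply: qle => //; rewrite invrK.
Qed.

Lemma cseminorm_nbhs q x (e : R) : cseminorm q -> 0 < e ->
  nbhs x [set y | q (y - x) < e].
Proof.
move=> [qS q1] e0.
apply: (nbhs_translate x (A := [set h | q h < e])).
apply: filterS (nbhs0_scale e^-1%:C q1) => y /=.
by rewrite (snormZ qS) rnorm_real ?invr_ge0 ?(ltW e0) // ltr_pdivrMl // mulr1.
Qed.

Lemma cseminorm_nbhsP x A : nbhs x A ->
  exists2 q, cseminorm q & forall y, q (y - x) < 1 -> A y.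
Proof.
move=> /nbhs_translate0 /exists_cseminorm[q qc qA]; exists q => // y /qA /=.
by rewrite subrKC.
Qed.

Lemma cseminorm_bounded q (A : set F) : cseminorm q -> tvs_bounded A ->
  exists2 M : R, 0 <= M & forall x, A x -> q x <= M.
Proof.
move=> [qS q1] /(_ _ q1)[t t0 At]; exists (rnorm t); first exact: rnorm_ge0.
move=> x /At[y /= qy <-]; rewrite (snormZ qS) ler_piMr ?rnorm_ge0 //.
exact: ltW.
Qed.

(** The closure of [0], which measures how far [F] is from being Hausdorff. *)
Definition cseminorm_null : set F := [set x | forall q, cseminorm q -> q x = 0].

Lemma cseminorm_null_subspace : subspace cseminorm_null.
Proof.
split=> [q [qS _]|a x y Nx Ny q qc]; first exact: snorm0 qS.
have qS := qc.1; apply/eqP; rewrite eq_le (snorm_ge0 qS) andbT.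
by rewrite (le_trans (snormD qS _ _)) // (snormZ qS) Nx // Ny // mulr0 addr0.
Qed.

End ContinuousSeminorms.

(** * Multilinear maps and polarization *)

Section Polarization.
Set Implicit Arguments.
Unset Strict Implicit.
Context {K : numFieldType} {V W : lmodType K}.

Lemma multilinear_sum k (b : ('I_k -> V) -> W) (J : finType) i u (a : J -> K)
    (v : J -> V) : multilinear b ->
  b (dfwith u i (\sum_j a j *: v j)) = \sum_j a j *: b (dfwith u i (v j)).
Proof.
move=> bL; have h := bL i u.
have h0 : b (dfwith u i 0) = 0.
  have := h (-1) 0 0; rewrite /= scaler0 addr0 => {1}->.
  by rewrite scaleN1r addNr.
apply: (big_ind2 (fun x y => b (dfwith u i x) = y)) => [//|x y x' y' <- <-|j _].
  by have := h 1 x x'; rewrite /= !scale1r.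
by have := h (a j) (v j) 0; rewrite /= h0 !addr0.
Qed.

Lemma multilinear_expand k (b : ('I_k -> V) -> W) (J : finType) (j0 : J)
    (a : 'I_k -> J -> K) (v : J -> V) : multilinear b ->
  b (fun i => \sum_j a i j *: v j) =
  \sum_(g : {ffun 'I_k -> J}) (\prod_i a i (g i)) *: b (fun i => v (g i)).
Proof.
move=> bL.
(* Only the first [n] arguments are expanded; the terms are indexed by the
   functions [g] that take the dummy value [j0] on the other indices. *)
pose A n := [pred g : {ffun 'I_k -> J} |
  [forall i : 'I_k, (n <= i)%N ==> (g i == j0)]].
suff main n : (n <= k)%N -> forall u,
    b (fun i : 'I_k => if (i < n)%N then \sum_j a i j *: v j else u i) =
    \sum_(g | A n g) (\prod_(i < k | (i < n)%N) a i (g i)) *: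
       b (fun i : 'I_k => if (i < n)%N then v (g i) else u i).
  have := main k (leqnn k) (fun=> 0).
  have -> : (fun i : 'I_k => if (i < k)%N then \sum_j a i j *: v j else 0) =
            (fun i => \sum_j a i j *: v j).
    by apply/funext => i; rewrite ltn_ord.
  move=> ->; apply: eq_big => [g|g _].
    by apply/forallP => i; rewrite leqNgt ltn_ord.
  congr (_ *: b _); last by apply/funext => i; rewrite ltn_ord.
  by apply: eq_bigl => i; rewrite ltn_ord.
elim: n => [_ u|n IH nk u].
  rewrite (big_pred1 [ffun=> j0]) => [|g].
    by rewrite big_pred0 ?scale1r.
  apply/forallP/eqP => [h|-> i]; last by rewrite ffunE eqxx.
  by apply/ffunP => i; rewrite ffunE; apply/eqP; have := h i.
pose i0 := Ordinal nk.
have E (X : 'I_k -> V) : (fun i : 'I_k => if (i < n.+1)%N then X i else u i) =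
    dfwith (fun i : 'I_k => if (i < n)%N then X i else u i) i0 (X i0).
  apply/funext => i; have [->|ii0] := eqVneq i i0.
    by rewrite dfwithin /= ltnSn.
  rewrite dfwithout 1?eq_sym // ltnS leq_eqVlt.
  suff -> : (i == n :> nat) = false by [].
  by apply/negbTE; apply: contra ii0 => /eqP h; apply/eqP/val_inj.
rewrite E (multilinear_sum _ _ _ _ bL).
have E' (X : 'I_k -> V) Y :
    dfwith (fun i : 'I_k => if (i < n)%N then X i else u i) i0 Y =
    (fun i : 'I_k => if (i < n)%N then X i else dfwith u i0 Y i).
  apply/funext => i; have [->|ii0] := eqVneq i i0.
    by rewrite !dfwithin /= ltnn.
  by rewrite !dfwithout // 1?eq_sym.
under eq_bigr => j _ do rewrite E' (IH (ltnW nk)) scaler_sumr.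
rewrite exchange_big /=.
pose upd (g : {ffun 'I_k -> J}) j : {ffun 'I_k -> J} :=
  [ffun i => if i == i0 then j else g i].
(* Group the functions [g] of the right-hand side by their values off [i0]. *)
rewrite [RHS](partition_big (fun g => upd g j0) (A n)); last first.
  move=> g /forallP Ag; apply/forallP => i; apply/implyP => ni; rewrite ffunE.
  case: (eqVneq i i0) => // ii0. apply: (implyP (Ag i)).
  rewrite ltn_neqAle ni andbT; apply: contra ii0 => /eqP h.
  by apply/eqP/val_inj.
apply: eq_bigr => h /forallP Ah.
rewrite [RHS](reindex_onto (upd h) (fun g => g i0)); last first.
  move=> g /andP[_ /eqP <-]; apply/ffunP => i; rewrite !ffunE.
  by case: (eqVneq i i0) => [->|].
apply: eq_big => [j|j _].
  symmetry; apply/andP; split; last by rewrite ffunE eqxx.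
  apply/andP; split.
    apply/forallP => i; apply/implyP => ni; rewrite ffunE.
    case: (eqVneq i i0) => [ii0|_]; first by move: ni; rewrite ii0 ltnn.
    by apply: (implyP (Ah i)); exact: ltnW.
  apply/eqP/ffunP => i; rewrite !ffunE; case: (eqVneq i i0) => // ->.
  by apply/esym/eqP; apply: (implyP (Ah i0)) => /=.
rewrite scalerA [in RHS](bigD1 i0) //= ffunE eqxx; congr (_ * _ *: b _).
  apply: eq_big => [i|i /= lin].
    rewrite ltnS [in RHS]leq_eqVlt andb_orl; case: (ltngtP i n) => //= h1.
      by symmetry; apply/eqP => ii0; move: h1; rewrite ii0 ltnn.
    by rewrite orbF; symmetry; apply/negbTE; rewrite negbK; apply/eqP/val_inj.
  rewrite ffunE; case: (eqVneq i i0) => // ii0.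
  by move: lin; rewrite ii0 /= ltnn.
apply/funext => i; rewrite ffunE ltnS; have [->|ii0] := eqVneq i i0.
  by rewrite dfwithin /= ltnn leqnn.
rewrite dfwithout 1?eq_sym // [in RHS]leq_eqVlt.
suff -> : (i == n :> nat) = false by [].
by apply/negbTE; apply: contra ii0 => /eqP h1; apply/eqP/val_inj.
Qed.

Lemma homogeneous_polyZ k (p : V -> W) (a : K) x :
  homogeneous_poly k p -> p (a *: x) = a ^+ k *: p x.
Proof.
move=> [b [bL pb]]; rewrite !pb.
have := multilinear_expand tt (fun _ _ => a) (fun=> x) bL.
have -> : (fun _ : 'I_k => \sum_(j : unit) a *: x) = (fun=> a *: x).
  by apply/funext => i; rewrite sumr_const card_unit.
move=> ->; rewrite prodr_const card_ord sumr_const.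
by rewrite card_ffun card_unit exp1n.
Qed.

(** The polarization formula recovers a symmetric multilinear form from its
    restriction to the diagonal; [s] runs over the subsets of the arguments. *)
Definition polar k (p : V -> W) (v : 'I_k -> V) : W :=
  (k`!%:R)^-1 *: \sum_(s : {ffun 'I_k -> bool})
    (\prod_i (-1) ^+ (~~ s i)) *: p (\sum_i (s i)%:R *: v i).

(** Expanding [p] at the sums over subsets yields terms [b (v \o g)], for maps [g]
    of the indices to themselves. By inclusion-exclusion only the surjective [g],
    that is the permutations, survive the alternating sum, so that the right-hand
    side is the symmetrization of [b]. *)
Lemma polarE k (p : V -> W) (b : ('I_k -> V) -> W) (v : 'I_k -> V) :
  (0 < k)%N -> multilinear b -> (forall x, p x = b (fun=> x)) ->
  polar p v = (k`!%:R)^-1 *: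
    \sum_(g : {ffun 'I_k -> 'I_k} | injectiveb g) b (fun i => v (g i)).
Proof.
move=> k0 bL pb; congr (_ *: _).
under eq_bigr => s _ do rewrite pb
  (multilinear_expand (Ordinal k0) (fun _ j => (s j)%:R) v bL) scaler_sumr.
rewrite exchange_big [RHS]big_mkcond /=; apply: eq_bigr => g _.
under eq_bigr => s _ do rewrite scalerA.
rewrite -scaler_suml.
suff -> : \sum_(s : {ffun 'I_k -> bool})
    (\prod_i (-1) ^+ (~~ s i)) * (\prod_i (s (g i))%:R) =
      (injectiveb g)%:R :> K.
  by case: injectiveb; rewrite ?scale1r ?scale0r.
pose G (j : 'I_k) (e : bool) : K := (-1) ^+ (~~ e) * \prod_(i | g i == j) e%:R.
transitivity (\sum_(s : {ffun 'I_k -> bool}) \prod_j G j (s j)).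
  apply: eq_bigr => s _; rewrite big_split /=; congr (_ * _).
  rewrite (partition_big g xpredT) //=; apply: eq_bigr => j _.
  by apply: eq_bigr => i /eqP->.
rewrite -bigA_distr_bigA /=.
have GE j : \sum_e G j e = ([exists i, g i == j])%:R.
  rewrite big_bool /G /= expr0 expr1 !mul1r mulN1r big1 //.
  case: existsP => [[i gi]|no].
    by rewrite (bigD1 i) //= mul0r subr0.
  by rewrite big_pred0 ?subrr // => i; apply/negP => gi; apply: no; exists i.
under eq_bigr do rewrite GE.
case: injectiveP => [/injF_onto inj|ninj].
  rewrite big1 // => j _; have /codomP[i ->] := inj j.
  by rewrite (_ : [exists _, _]) //; apply/existsP; exists i.
have [j nj] : exists j, ~~ [exists i, g i == j].
  apply/existsP; apply: contraT; rewrite negb_exists => /forallP hit.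
  exfalso; apply: ninj; have : #|codom g| == #|'I_k|.
    apply/eqP/eq_card => j; have := hit j.
    by rewrite negbK => /existsP[i /eqP <-]; rewrite codom_f.
  by move=> /image_injP inj x y; exact: inj.
by rewrite (bigD1 j) //= (negbTE nj) mul0r.
Qed.

Lemma polar_multilinear k (p : V -> W) : (0 < k)%N -> homogeneous_poly k p ->
  multilinear (polar p : ('I_k -> V) -> W).
Proof.
move=> k0 [b [bL pb]] i v a x y; rewrite !(polarE _ k0 bL pb).
rewrite scalerA [a * _]mulrC -scalerA -scalerDr; congr (_ *: _).
rewrite scaler_sumr -big_split /=; apply: eq_bigr => g /injectiveP ginj.
have /codomP[i' ii'] := injF_onto ginj i.
have E z : (fun j => dfwith v i z (g j)) = dfwith (fun j => v (g j)) i' z.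
  apply/funext => j; have [->|ji'] := eqVneq j i'.
    by rewrite -ii' !dfwithin.
  have igj : i != g j by rewrite ii' (inj_eq ginj) eq_sym.
  by rewrite [LHS]dfwithout // [RHS]dfwithout // eq_sym.
by rewrite !E; exact: bL.
Qed.

Lemma polar_diag k (p : V -> W) x : (0 < k)%N -> homogeneous_poly k p ->
  polar p (fun _ : 'I_k => x) = p x.
Proof.
move=> k0 [b [bL pb]]; rewrite (polarE _ k0 bL pb) -pb sumr_const.
have f0 : k`!%:R != 0 :> K by rewrite pnatr_eq0 -lt0n fact_gt0.
rewrite -(_ : k`! = #|[pred g : {ffun 'I_k -> 'I_k} | injectiveb g]|).
  by rewrite -(scaler_nat _ (p x)) scalerA mulVf // scale1r.
by rewrite -ffactnn -{1 2}(card_ord k) -card_inj_ffuns cardsE.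
Qed.

End Polarization.

(** * Bounded analytic maps on a ball of a normed space *)

Section SeriesAlgebra.
Set Implicit Arguments.
Unset Strict Implicit.
Context {R : realType} {F : lmodType R[i]} {q : F -> R} (qS : seminorm q).
Implicit Types (c : nat -> F) (g : R[i] -> F).

Lemma hassumB c c' z y y' : hassum q c z y -> hassum q c' z y' ->
  hassum q (fun k => c k - c' k) z (y - y').
Proof.
move=> h h' e e0; have e2 : 0 < e / 2 by lra.
apply: filterS2 (h _ e2) (h' _ e2) => d hd hd'.
rewrite -psumB (_ : _ - _ = (y - psum c d z) - (y' - psum c' d z)).
  by rewrite (le_trans (snormB qS _ _)) //; lra.
by rewrite [in LHS]opprD addrACA -opprD.
Qed.

Lemma hassum_coef_unique c c' g t k : 0 < t ->
  (forall z, rnorm z < t -> hassum q c z (g z)) ->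
  (forall z, rnorm z < t -> hassum q c' z (g z)) -> q (c k - c' k) = 0.
Proof.
move=> t0 h h'; apply/eqP; rewrite eq_le (snorm_ge0 qS) andbT.
have t2 : 0 < t / 2 by lra.
have tt : t / 2 < t by lra.
have hh z (zt : rnorm z < t) := hassumB (h z zt) (h' z zt).
rewrite -(pmulr_lle0 _ (exprn_gt0 k t2)).
by apply: (cauchy_sum qS hh k (ltW t2) tt) => z _; rewrite subrr (snorm0 qS).
Qed.

Lemma hassum_at0 c y : hassum q c 0 y -> q (y - c 0%N) = 0.
Proof.
move=> h; apply/eqP; rewrite eq_le (snorm_ge0 qS) andbT.
apply/ler_addgt0Pl => e e0; rewrite addr0.
have [D _ HD] := h e e0; have := HD D.+1 (leqnSn D).
rewrite /psum big_ord_recl big1 ?addr0 ?expr0 ?scale1r // => i _.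
by rewrite exprS mul0r scale0r.
Qed.

End SeriesAlgebra.

Section NormedSpace.
Set Implicit Arguments.
Unset Strict Implicit.
Context {R : realType} {V : normedModType R[i]} {F : tvsType R[i]}.
Implicit Types (a b h x y : V) (q : F -> R).

Lemma rnormZ (z : R[i]) x : rnorm (z *: x) = rnorm z * rnorm x.
Proof. by apply: complexI; rewrite rmorphM /= -!rnormE normrZ. Qed.

Lemma rnorm_ball (r : R) x : ball (0 : V) r%:C x <-> rnorm x < r.
Proof. by rewrite -ball_normE /= sub0r normrN rnormE ltcR. Qed.

Lemma nbhs_rnormP a (A : set V) : nbhs a A <->
  exists2 e : R, 0 < e & forall x, rnorm (x - a) < e -> A x.
Proof.
split=> [/nbhs_ballP[e e0 eA]|[e e0 eA]].
  exists (complex.Re e); first by move: e0; rewrite /= ltcE => /andP[].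
  move=> x xa; apply: eA; rewrite -ball_normE /= distrC rnormE.
  have -> : e = (complex.Re e)%:C by rewrite RRe_real // ger0_real // ltW.
  by rewrite ltcR.
apply/nbhs_ballP; exists e%:C; first by rewrite /= ltcR.
by move=> x; rewrite -ball_normE /= distrC rnormE ltcR => /eA.
Qed.

Lemma series_psum (c : nat -> F) d : series c d = psum c d 1.
Proof.
rewrite /series /= big_mkord; apply: eq_bigr => k _.
by rewrite expr1n scale1r.
Qed.

Lemma cvg_hassum q (c : nat -> F) (y : F) : cseminorm q ->
  series c @ \oo --> y -> hassum q c 1 y.
Proof.
move=> qc cy e e0; have : \forall d \near \oo, q (series c d - y) < e.
  exact: (cy _ (cseminorm_nbhs y qc e0)).
by apply: filterS => d /ltW; rewrite (snormBC qc.1) series_psum.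
Qed.

Lemma hassum_cvg (c : nat -> F) (y : F) :
  (forall q, cseminorm q -> hassum q c 1 y) ->
  series c @ \oo --> y.
Proof.
move=> cy A /cseminorm_nbhsP[q qc qA].
have h2 : 0 < 2^-1 :> R by lra.
have := cy q qc _ h2; apply: filterS => d /= qd; apply: qA.
rewrite (snormBC qc.1) series_psum; apply: (le_lt_trans qd); lra.
Qed.

Definition expansion (g : V -> F) (p : nat -> V -> F) a : Prop :=
  (forall k, homogeneous_poly k (p k)) /\
  \forall x \near a, series (fun k => p k (x - a)) @ \oo --> g x.

Lemma expansion_line g p a h q : cseminorm q -> expansion g p a ->
  exists2 d : R, 0 < d &
    forall w, rnorm w < d -> hassum q (p^~ h) w (g (a + w *: h)).
Proof.
move=> qc [pH /nbhs_rnormP[e e0 ea]].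
have h1 : 0 < rnorm h + 1 by rewrite ltr_wpDl // rnorm_ge0.
exists (e / (rnorm h + 1)); first by rewrite divr_gt0.
move=> w wd.
have /ea/(cvg_hassum qc) : rnorm (a + w *: h - a) < e.
  rewrite addrAC subrr add0r rnormZ.
  rewrite (@le_lt_trans _ _ (rnorm w * (rnorm h + 1))) //.
    by rewrite ler_wpM2l ?rnorm_ge0 // lerDl.
  by rewrite -ltr_pdivlMr.
rewrite addrAC subrr add0r => H e' /H; apply: filterS => d.
rewrite /psum; under eq_bigr => k _ do
  rewrite expr1n scale1r (homogeneous_polyZ _ _ (pH k)).
by [].
Qed.

Section Bounded.
Variables (g : V -> F) (r : R).
Hypothesis g_analytic : analytic_on (ball (0 : V) r%:C) g.

Lemma analytic_expansion a : rnorm a < r -> exists p, expansion g p a.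
Proof.
move=> /rnorm_ball ar; have [_ _ /(_ a ar)[p [pH pa]]] := g_analytic.
by exists p; split=> // k; case: (pH k).
Qed.

Section Estimates.
Variables (q : F -> R) (M : R).
Hypothesis qc : cseminorm q.
Hypothesis gM : forall x, rnorm x < r -> q (g x) <= M.
Let qS : seminorm q := qc.1.

(** Apply the result on maximal discs along the line through [a] in the direction
    [h]. At [z = 0] the given expansion [p] has to be used, at the other points
    any one. *)
Lemma expansion_disc a p h (T : R) : expansion g p a ->
  rnorm a + T * rnorm h <= r -> rnorm a < r ->
  forall z, rnorm z < T -> hassum q (p^~ h) z (g (a + z *: h)).
Proof.
move=> pa aT ar z zT.
have inr (b : R[i]) : rnorm b < T -> rnorm (a + b *: h) < r.
  move=> bT; have [->|h0] := eqVneq h 0; first by rewrite scaler0 addr0.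
  rewrite (le_lt_trans (rnormD _ _)) // rnormZ (lt_le_trans _ aT) // ltrD2l.
  by rewrite ltr_pM2r // rnorm_gt0.
have ex b : exists p', rnorm b < r -> expansion g p' b.
  have [br|//] := boolP (rnorm b < r); last by exists p.
  by have [p' p'b] := analytic_expansion br; exists p'.
have [P HP] := choice ex.
pose c (b : R[i]) := if b == 0 then p^~ h else (P (a + b *: h))^~ h.
have := @hassum_maximal_disc _ _ q qS c (fun b : R[i] => g (a + b *: h)) T M.
have -> : c 0 = p^~ h by rewrite /c eqxx.
apply=> //; last by move=> b /inr/gM.
move=> b bT.
have [d d0 Hd] : exists2 d : R, 0 < d &
    forall w, rnorm w < d -> hassum q (c b) w (g (a + b *: h + w *: h)).
  rewrite /c; case: eqVneq => [->|_].
    by rewrite scale0r addr0; exact: expansion_line.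
  by apply: expansion_line => //; exact/HP/inr.
by exists d => // w /Hd; rewrite scalerDl addrA.
Qed.

(** On the line through [x] and [y] the map [g] is a power series converging on a
    disc of radius [T = rho / rnorm (y - x)]. If [T] is large, then the terms of
    positive degree add up to at most a multiple of [M / T] at [1] by Cauchy's
    estimates; if [T] is at most [4], then [2 * M] is a good enough bound. *)
Lemma analytic_lipschitz (rho : R) x y : 0 < rho -> rnorm x + rho <= r ->
  rnorm y < r -> q (g y - g x) <= 8 * M / rho * rnorm (y - x).
Proof.
move=> rho0 xr yr.
have xr' : rnorm x < r by lra.
have M0 : 0 <= M by apply: le_trans (gM xr'); exact: snorm_ge0 qS _.
have [->|yx] := eqVneq y x; first by rewrite !subrr (snorm0 qS) rnorm0 mulr0.
pose h := y - x.
have h0 : 0 < rnorm h by rewrite rnorm_gt0 subr_eq0.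
pose T := rho / rnorm h.
have T0 : 0 < T by rewrite divr_gt0.
have -> : 8 * M / rho * rnorm (y - x) = 8 * M / T.
  by rewrite /T invf_div mulrA mulrAC.
have [T4|T4] := lerP T 4.
  rewrite (le_trans (snormB qS _ _)) // (@le_trans _ _ (2 * M)) //.
    by have := gM xr'; have := gM yr; lra.
  by rewrite ler_pdivlMr //; nra.
have [p px] := analytic_expansion xr'.
have Th : rnorm x + T * rnorm h <= r by rewrite divfK ?gt_eqF.
have H := expansion_disc px Th xr'.
clearbody T.
have T20 : 0 <= T / 2 by lra.
have T2T : T / 2 < T by lra.
have cB k : q (p k h) * (T / 2) ^+ k <= M.
  apply: (cauchy_sum qS H k T20 T2T) => z zT.
  apply: gM; rewrite (le_lt_trans (rnormD _ _)) // rnormZ zT.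
  rewrite (lt_le_trans _ Th) // ltrD2l ltr_pM2r //.
pose u := (T / 2)^-1.
have u0 : 0 <= u by rewrite invr_ge0.
have u2 : u <= 2^-1 by rewrite lef_pV2 ?posrE //; lra.
have H1 : hassum q (p^~ h) 1 (g y).
  have /H : rnorm (1 : R[i]) < T by rewrite rnorm1; lra.
  by rewrite scale1r /h subrKC.
have H0 : q (g x - p 0%N h) = 0.
  have /H : rnorm (0 : R[i]) < T by rewrite rnorm0.
  by rewrite scale0r addr0 => /(hassum_at0 qS).
have cB' k : q (p k h) * rnorm (1 : R[i]) ^+ k <= M * u ^+ k.
  rewrite rnorm1 expr1n mulr1 /u exprVn ler_pdivlMr ?exprn_gt0 //; lra.
have u1 : u < 1 by lra.
have := hassum_tail qS 1 u0 u1 M0 cB' H1.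
rewrite /psum big_ord1 expr0 scale1r expr1 => H2.
rewrite (le_trans (snorm_tri qS (p 0%N h) _ _)) //.
rewrite [X in _ + X](snormBC qS) H0 addr0.
apply: (le_trans H2).
have -> : 8 * M / T = 4 * (M * u).
  by rewrite /u invf_div; ring.
have Mu : 0 <= M * u by rewrite mulr_ge0.
rewrite ler_pdivrMr; last by lra.
by nra.
Qed.

(** Cauchy's estimate for the series [p k x - p k y], whose sum on the circle of
    radius [t] is bounded by the Lipschitz estimate for [g]. The constant depends
    on [g] only through [M], as needed in the limit. *)
Lemma expansion_lipschitz (rho t sigma : R) a p x y k : expansion g p a ->
  0 < rho -> rnorm a + 2 * rho <= r -> 0 < t -> t * sigma <= rho ->
  rnorm x <= sigma -> rnorm y <= sigma ->
  q (p k x - p k y) * t ^+ k <= 8 * M / rho * t * rnorm (x - y).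
Proof.
move=> pa rho0 ar t0 ts xs ys.
have ar' : rnorm a < r by lra.
have aT (v : V) : rnorm v <= sigma -> rnorm a + 2 * t * rnorm v <= r.
  move=> vs; rewrite (le_trans _ ar) // lerD2l -mulrA ler_pM2l //.
  by rewrite (le_trans _ ts) // ler_pM2l.
have H (z : R[i]) (zt : rnorm z < 2 * t) := hassumB qS
  (expansion_disc pa (aT _ xs) ar' zt) (expansion_disc pa (aT _ ys) ar' zt).
have tt : t < 2 * t by lra.
apply: (cauchy_sum qS H k (ltW t0) tt) => z zt.
have zv (v : V) : rnorm v <= sigma -> rnorm (a + z *: v) <= rnorm a + rho.
  move=> vs; rewrite (le_trans (rnormD _ _)) // lerD2l rnormZ zt.
  by rewrite (le_trans _ ts) // ler_pM2l.
have yr : rnorm (a + z *: y) + rho <= r by have := zv _ ys; lra.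
have xr : rnorm (a + z *: x) < r by have := zv _ xs; lra.
have := analytic_lipschitz rho0 yr xr.
by rewrite opprD addrACA subrr add0r -scalerBr rnormZ zt mulrA.
Qed.

End Estimates.
End Bounded.
End NormedSpace.

(** * Direct limits of normed spaces *)

Section DirectSystem.
Set Implicit Arguments.
Unset Strict Implicit.
Context {R : realType} {E : tvsType R[i]}.

Lemma op_norm_contraction {V W : normedModType R[i]} (u : {linear V -> W}) :
  (op_norm u <= 1)%E -> forall x, rnorm (u x) <= rnorm x.
Proof.
move=> u1 x; have [->|x0] := eqVneq x 0; first by rewrite linear0 !rnorm0.
have nx : 0 < rnorm x by rewrite rnorm_gt0.
pose y := (rnorm x)^-1%:C *: x.
have y1 : rnorm y = 1.
  by rewrite rnormZ rnorm_real ?invr_ge0 ?(ltW nx) // mulVf ?gt_eqF.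
have : ((rnorm (u y))%:E <= 1)%E.
  apply: le_trans u1; apply: ereal_sup_ubound; exists y => //=.
  by rewrite rnormE y1.
rewrite lee_fin /y linearZ /= rnormZ rnorm_real ?invr_ge0 ?(ltW nx) //.
by rewrite ler_pdivrMl // mulr1.
Qed.

Lemma rnorm_convex {V : normedModType R[i]} (e s t : R) (u v : V) :
  0 <= s -> 0 <= t -> s + t = 1 -> rnorm u < e -> rnorm v < e ->
  rnorm (s%:C *: u + t%:C *: v) < e.
Proof.
move=> s0 t0 st ue ve.
rewrite (le_lt_trans (rnormD _ _)) // !rnormZ !rnorm_real //.
have -> : t = 1 - s by lra.
have s1 : s <= 1 by lra.
have [s2|s2] := lerP s 2^-1; nra.
Qed.

(** A form of the hypotheses on [E] that is inherited when finitely many of the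
    spaces [En n] are dropped, see [contractive_limit_shift]. *)
Definition contractive_limit (En : nat -> normedModType R[i])
    (incl : forall n, {linear En n -> E})
    (bond : forall n, {linear En n -> En n.+1}) : Prop :=
  [/\ (forall n, injective (incl n)),
      (forall n (x : En n), incl n.+1 (bond n x) = incl n x),
      (forall x : E, exists n (u : En n), incl n u = x),
      (forall n (x : En n), rnorm (bond n x) <= rnorm x) &
      lc_direct_limit incl].

Section System.
Context {En : nat -> normedModType R[i]} {incl : forall n, {linear En n -> E}}
  {bond : forall n, {linear En n -> En n.+1}}.
Hypothesis sys : contractive_limit incl bond.

Lemma lift_le n m (u : En n) : (n <= m)%N ->
  exists2 v : En m, incl m v = incl n u & rnorm v <= rnorm u.
Proof.
have [_ bondE _ bond1 _] := sys.
elim: m => [|m IH].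
  by rewrite leqn0 => /eqP n0; subst n; exists u.
rewrite leq_eqVlt => /orP[/eqP nm|]; first by subst n; exists u.
rewrite ltnS => /IH[v vu vn]; exists (bond m v); first by rewrite bondE.
by rewrite (le_trans (bond1 _ _)).
Qed.

Lemma rnorm_lift n m (u : En n) (v : En m) : (n <= m)%N ->
  incl m v = incl n u -> rnorm v <= rnorm u.
Proof.
have [inj _ _ _ _] := sys.
by move=> /(lift_le u)[w <- wu] /inj ->.
Qed.

Lemma lift_family k (v : 'I_k -> E) :
  exists n (w : 'I_k -> En n), v = fun i => incl n (w i).
Proof.
have [_ _ surj _ _] := sys.
have [d Hd] := choice (fun i => surj (v i)).
pose n := \max_i d i; exists n.
have ex i : exists w : En n, incl n w = v i.
  have [u <-] := Hd i.
  by have [w <- _] := lift_le u (leq_bigmax i : (d i <= n)%N); exists w.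
by have [w Hw] := choice ex; exists w; apply/funext => i.
Qed.

Lemma lift_pair_family k (v : 'I_k -> E) (x y : E) :
  exists n (w : 'I_k -> En n) (x' y' : En n),
  [/\ v = (fun i => incl n (w i)), x = incl n x' & y = incl n y'].
Proof.
have [_ _ surj _ _] := sys.
have [n [w ->]] := lift_family v.
have [nx [x' <-]] := surj x; have [ny [y' <-]] := surj y.
pose N := maxn n (maxn nx ny).
have nN : (n <= N)%N by rewrite leq_maxl.
have nxN : (nx <= N)%N by rewrite (leq_trans (leq_maxl nx ny)) // leq_maxr.
have nyN : (ny <= N)%N by rewrite (leq_trans (leq_maxr nx ny)) // leq_maxr.
have ex i : exists w' : En N, incl N w' = incl n (w i).
  by have [w' ? _] := lift_le (w i) nN; exists w'.
have [w' Hw'] := choice ex.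
have [x1 Hx _] := lift_le x' nxN; have [y1 Hy _] := lift_le y' nyN.
by exists N, w', x1, y1; split=> //; apply/funext => i.
Qed.

Lemma glue_limit {X : Type} (h : forall n, En n -> X) :
  (forall n (u : En n), h n.+1 (bond n u) = h n u) ->
  exists f : E -> X, forall n (u : En n), f (incl n u) = h n u.
Proof.
have [inj bondE surj _ _] := sys => hb.
have lift n m (u : En n) : (n <= m)%N ->
    exists2 v : En m, incl m v = incl n u & h m v = h n u.
  elim: m => [|m IH].
    by rewrite leqn0 => /eqP n0; subst n; exists u.
  rewrite leq_eqVlt => /orP[/eqP nm|]; first by subst n; exists u.
  rewrite ltnS => /IH[v vu vn]; exists (bond m v); first by rewrite bondE.
  by rewrite hb.
have compat n m (u : En n) (v : En m) : incl n u = incl m v -> h n u = h m v.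
  wlog nm : n m u v / (n <= m)%N.
    move=> H; case/orP: (leq_total n m) => nm uv; first exact: H.
    by symmetry; apply: H.
  by have [w <- <-] := lift _ _ u nm => /inj ->.
have ex x : exists y, forall n (u : En n), incl n u = x -> h n u = y.
  have [n [u ux]] := surj x; exists (h n u) => m v vx.
  by apply: compat; rewrite ux.
have [f Hf] := choice ex.
by exists f => n u; rewrite (Hf (incl n u) n u).
Qed.

(** The multilinear maps given on the spaces [En n] need not be compatible with
    each other, but the polarization of [P] is built from finitely many values of
    [P], so it agrees on each [En n] with the polarization of the restriction. *)
Lemma homogeneous_poly_limit {W : lmodType R[i]} k (P : E -> W) :
  (forall n, homogeneous_poly k (P \o incl n)) -> homogeneous_poly k P.
Proof.
have [_ _ surj _ _] := sys => hP.
have [k0|k0] := posnP k.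
  subst k; exists (fun=> P 0); split=> [[]//|x].
  have [n [u <-]] := surj x.
  have [b [_ bP]] := hP n; have /= := bP u => ->.
  rewrite -(linear0 (incl n)); have /= := bP 0 => ->.
  by congr b; apply/funext => -[].
have pE n (w : 'I_k -> En n) :
    polar P (fun i => incl n (w i)) = polar (P \o incl n) w.
  congr (_ *: _); apply: eq_bigr => s _; congr (_ *: _) => /=.
  by rewrite linear_sum; congr P; apply: eq_bigr => i _; rewrite linearZ.
exists (fun v => polar P v); split=> [i v a x y|x]; last first.
  by have [n [u <-]] := surj x; rewrite pE polar_diag.
have [n [w [x' [y' [-> -> ->]]]]] := lift_pair_family v x y.
have E0 z : dfwith (fun i => incl n (w i)) i (incl n z) =
    (fun j => incl n (dfwith w i z j)).
  apply/funext => j; have [->|ji] := eqVneq j i; first by rewrite !dfwithin.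
  by rewrite !dfwithout // eq_sym.
rewrite -linearP !E0 !pE; exact: (polar_multilinear k0 (hP n)).
Qed.

Lemma nbhs_limit_ball (rho : R) : 0 < rho ->
  nbhs (0 : E) [set x | exists n (u : En n), x = incl n u /\ rnorm u < rho].
Proof.
have [_ _ _ _ lim] := sys => rho0; apply/lim; last first.
  move=> n; apply/nbhs_rnormP; exists rho => // x; rewrite subr0 => xr.
  by exists n, x.
apply/convex_setRP => _ _ s t s0 t0 st [n [u [-> ur]]] [m [v [-> vr]]].
have [u' <- u'u] := lift_le u (leq_maxl n m).
have [v' <- v'v] := lift_le v (leq_maxr n m).
exists (maxn n m), (s%:C *: u' + t%:C *: v'); split.
  by rewrite linearD !linearZ.
by apply: rnorm_convex => //; [exact: le_lt_trans ur|exact: le_lt_trans vr].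
Qed.

(** As the topology of [E] is the locally convex direct limit topology, the union
    over [n] of these algebraic sums of balls is a neighbourhood of [0], however
    small the radii [eps n] are, see [nbhs_ball_sum]. *)
Fixpoint ball_sum (eps : nat -> R) n : set E :=
  match n with
  | 0 => incl 0 @` [set u | rnorm u < eps 0]
  | n'.+1 => [set x | exists y (v : En n'.+1),
      [/\ ball_sum eps n' y, rnorm v < eps n'.+1 & x = y + incl n'.+1 v]]
  end.

Lemma ball_sum_ball eps n (u : En n) : (forall n, 0 < eps n) ->
  rnorm u < eps n -> ball_sum eps n (incl n u).
Proof.
move=> eps0; case: n u => [|n] u un; first by exists u.
exists 0, u; split=> //; last by rewrite add0r.
elim: n {u un} => [|n IH]; first by exists 0; rewrite ?linear0 //= rnorm0.
by exists 0, 0; rewrite rnorm0 linear0 addr0; split.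
Qed.

Lemma ball_sum_le eps n m : (forall n, 0 < eps n) -> (n <= m)%N ->
  ball_sum eps n `<=` ball_sum eps m.
Proof.
move=> eps0; elim: m => [|m IH]; first by rewrite leqn0 => /eqP->.
rewrite leq_eqVlt => /orP[/eqP->//|]; rewrite ltnS => /IH nm x /nm xm.
by exists x, 0; rewrite rnorm0 linear0 addr0; split.
Qed.

Lemma nbhs_ball_sum eps : (forall n, 0 < eps n) ->
  nbhs (0 : E) (\bigcup_n ball_sum eps n).
Proof.
have [_ _ _ _ lim] := sys => eps0; apply/lim; last first.
  move=> n; apply/nbhs_rnormP; exists (eps n) => // x; rewrite subr0 => xn.
  by exists n => //; exact: ball_sum_ball.
apply/convex_setRP => x y s t s0 t0 st [n _ xn] [m _ ym].
exists (maxn n m) => //.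
have {}xn := ball_sum_le eps0 (leq_maxl n m) xn.
have {}ym := ball_sum_le eps0 (leq_maxr n m) ym.
elim: (maxn n m) x y xn ym => [|N IH] x y.
  move=> [u un <-] [v vn <-]; exists (s%:C *: u + t%:C *: v).
    exact: rnorm_convex.
  by rewrite linearD !linearZ.
move=> [x1 [u [x1N un ->]]] [y1 [v [y1N vn ->]]].
exists (s%:C *: x1 + t%:C *: y1), (s%:C *: u + t%:C *: v); split.
- exact: IH.
- exact: rnorm_convex.
- by rewrite !scalerDr (linearD (incl N.+1)) !linearZ addrACA.
Qed.

(** The Lipschitz constants may grow with [n], what matters is that the radius
    [rho] does not shrink. A sum of elements of the balls of radius [eps n] in
    [En n] is reached by adding one term after the other. If the radii [eps n]
    decrease fast enough, then the partial sums stay in the balls of radius [rho]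
    (here the contractivity of the bonding maps is used), and by the Lipschitz
    estimate in [En n] adding the [n]-th term moves the value of [f] by at most
    [2 ^- n.+1]. *)
Lemma lipschitz_continuous_at {F : tvsType R[i]} (f : E -> F) (a : En 0)
    (rho : R) : 0 < rho ->
  (forall q, cseminorm q -> forall n, exists L : R, 0 <= L /\
    forall (b : En n), incl n b = incl 0 a -> forall x y : En n,
      rnorm x < rho -> rnorm y < rho ->
      q (f (incl n (b + x)) - f (incl n (b + y))) <= L * rnorm (x - y)) ->
  {for incl 0 a, continuous f}.
Proof.
have [_ bondE _ bond1 _] := sys => rho0 lip A /cseminorm_nbhsP[q qc qA].
have [L HL] := choice (lip q qc).
have qS := qc.1.
pose eps n : R := Num.min rho (L n + 1)^-1 / 2 ^+ n.+1.
have m0 n : 0 < Num.min rho (L n + 1)^-1.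
  by rewrite lt_min rho0 invr_gt0 ltr_wpDl // (HL n).1.
have eps0 n : 0 < eps n by rewrite divr_gt0 // exprn_gt0.
have half n : (2 ^+ n.+1)^-1 + (2 ^+ n.+1)^-1 = (2 ^+ n)^-1 :> R.
  by rewrite exprS invfM; field; rewrite ?expf_neq0.
have eps_rho n : eps n <= rho / 2 ^+ n.+1.
  by rewrite ler_wpM2r ?invr_ge0 ?exprn_ge0 // ge_min lexx.
have eps_L n : L n * eps n <= (2 ^+ n.+1)^-1.
  rewrite /eps mulrA ler_piMl ?invr_ge0 ?exprn_ge0 //.
  have L0 := (HL n).1.
  rewrite (@le_trans _ _ (L n * (L n + 1)^-1)) //.
    by rewrite ler_wpM2l // ge_min lexx orbT.
  by rewrite ler_pdivrMr ?mul1r ?lerDl // ltr_wpDl.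
have main n : forall x, ball_sum eps n x -> exists b u : En n,
    [/\ incl n b = incl 0 a, x = incl n u,
      rnorm u < rho * (1 - (2 ^+ n.+1)^-1) &
      q (f (incl 0 a + x) - f (incl 0 a)) <= 1 - (2 ^+ n.+1)^-1].
  have lt_rho m : rho * (1 - (2 ^+ m.+1)^-1) < rho.
    by rewrite gtr_pMr // gtrBl invr_gt0 exprn_gt0.
  have step m (b : En m) (u v : En m) (x : E) :
      incl m b = incl 0 a -> x = incl m u ->
      rnorm u <= rho * (1 - (2 ^+ m)^-1) -> rnorm v < eps m ->
      q (f (incl 0 a + x) - f (incl 0 a)) <= 1 - (2 ^+ m)^-1 ->
      rnorm (u + v) < rho * (1 - (2 ^+ m.+1)^-1) /\
      q (f (incl 0 a + (x + incl m v)) - f (incl 0 a)) <= 1 - (2 ^+ m.+1)^-1.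
    move=> ba -> um vm qm.
    have uv : rnorm (u + v) < rho * (1 - (2 ^+ m.+1)^-1).
      rewrite (le_lt_trans (rnormD _ _)) //.
      have := eps_rho m; have := half m; nra.
    split=> //.
    rewrite (le_trans (snorm_tri qS (f (incl 0 a + incl m u)) _ _)) //.
    have ur : rnorm u < rho.
      apply: (le_lt_trans um).
      by rewrite gtr_pMr // gtrBl invr_gt0 exprn_gt0.
    have := (HL m).2 b ba (u + v) u (lt_trans uv (lt_rho m)) ur.
    rewrite !linearD /= ba addrAC subrr add0r => h.
    have h2 : L m * rnorm v <= (2 ^+ m.+1)^-1.
      by apply: le_trans (eps_L m); rewrite ler_wpM2l ?(HL m).1 // ltW.
    have := half m; lra.
  elim: n => [|n IH] x.
    move=> [v vn <-].
    have [||h1 h2] := @step 0 a 0 v 0 erefl (esym (linear0 _)) _ vn.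
    - by rewrite rnorm0 expr0 invr1 subrr mulr0.
    - by rewrite addr0 expr0 invr1 !subrr (snorm0 qS).
    by exists a, v; rewrite !add0r in h1 h2; split.
  move=> [y [v [/IH[b [u [ba -> un qn]]] vn ->]]].
  have [b' b'b _] := lift_le b (leqnSn n).
  exists b', (bond n u + v).
  have [|||h1 h2] := step n.+1 b' (bond n u) v (incl n u) _ _ _ vn qn.
  - by rewrite b'b.
  - by rewrite bondE.
  - exact: le_trans (bond1 _ _) (ltW un).
  by split=> //; [rewrite b'b|rewrite linearD /= bondE].
have := nbhs_translate (incl 0 a) (nbhs_ball_sum eps0).
apply: filterS => x [n _ /main[b [u [_ _ _ h]]]]; apply: qA.
rewrite subrKC in h; apply: (le_lt_trans h).
by rewrite gtrBl invr_gt0 exprn_gt0.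
Qed.

End System.

(** A neighbourhood of [0] in [En (n + m)] restricts to one in [En n] since the
    bonding maps are contractive, so the topology of [E] is determined by the
    remaining spaces. *)
Lemma contractive_limit_shift {En : nat -> normedModType R[i]}
    {incl : forall n, {linear En n -> E}}
    {bond : forall n, {linear En n -> En n.+1}} m :
  contractive_limit incl bond ->
  @contractive_limit (fun n => En (n + m)%N) (fun n => incl (n + m)%N)
    (fun n => bond (n + m)%N).
Proof.
move=> sys; have [inj bondE surj bond1 lim] := sys; split.
- by move=> n; exact: inj.
- by move=> n; exact: bondE.
- move=> x; have [n [u <-]] := surj x.
  by have [v ? _] := lift_le sys u (leq_addr m n); exists n, v.
- by move=> n; exact: bond1.
move=> W Wcv; rewrite (lim W Wcv); split=> h n; first exact: h.
have /nbhs_rnormP[e e0 He] := h n; apply/nbhs_rnormP; exists e => // u.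
have [v /= vu v1] := lift_le sys u (leq_addr m n).
rewrite subr0 => ue; have := He v; rewrite subr0 /= vu; apply.
exact: le_lt_trans ue.
Qed.

End DirectSystem.

(** * Analyticity on the union of balls *)

Section LimitAnalytic.
Set Implicit Arguments.
Unset Strict Implicit.
Context {R : realType} {E F : tvsType R[i]} {En : nat -> normedModType R[i]}
  {incl : forall n, {linear En n -> E}}
  {bond : forall n, {linear En n -> En n.+1}}.
Hypothesis sys : contractive_limit incl bond.
Variables (r : R) (f : E -> F) (a : En 0).
Hypothesis ar : rnorm a < r.
Hypothesis fn_analytic :
  forall n, analytic_on (ball (0 : En n) r%:C) (f \o incl n).
Hypothesis fn_bounded :
  forall n, tvs_bounded ((f \o incl n) @` ball (0 : En n) r%:C).

Lemma ball_image_bounded q n : cseminorm q ->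
  exists2 M : R, 0 <= M & forall x : En n, rnorm x < r -> q (f (incl n x)) <= M.
Proof.
move=> qc; have [M M0 HM] := cseminorm_bounded qc (fn_bounded n).
by exists M => // x /rnorm_ball xr; apply: HM; exists x.
Qed.

Lemma nbhs_union_balls :
  nbhs (incl 0 a) (\bigcup_n (incl n @` ball (0 : En n) r%:C)).
Proof.
have rho0 : 0 < r - rnorm a by rewrite subr_gt0.
have := nbhs_translate (incl 0 a) (nbhs_limit_ball sys rho0).
apply: filterS => x [n [u [xu ur]]]; exists n => //.
have [b ba bn] := lift_le sys a (leq0n n).
exists (b + u); last by rewrite linearD /= ba -xu subrKC.
apply/rnorm_ball; rewrite (le_lt_trans (rnormD _ _)) // ; lra.
Qed.

Lemma limit_continuous : {for incl 0 a, continuous f}.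
Proof.
pose rho := (r - rnorm a) / 2.
have rho0 : 0 < rho by rewrite divr_gt0 ?subr_gt0.
have rhoE : 2 * rho = r - rnorm a by rewrite /rho; field.
clearbody rho.
apply: (lipschitz_continuous_at sys rho0) => q qc n.
have [M M0 HM] := ball_image_bounded n qc.
exists (8 * M / rho); split; first by rewrite divr_ge0 ?mulr_ge0 // ltW.
move=> b ba x y xr yr.
have bn := rnorm_lift sys (leq0n n) ba.
have yb := rnormD b y; have xb := rnormD b x.
have h1 : rnorm (b + y) + rho <= r by lra.
have h2 : rnorm (b + x) < r by lra.
have := analytic_lipschitz (@fn_analytic n) qc HM rho0 h1 h2.
by rewrite /= opprD addrACA subrr add0r.
Qed.

(** The Taylor polynomials [pn n] of the restrictions at [a] are compatible only
    up to the closure of [0] in [F], by uniqueness of power series expansions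
    along lines. Composed with a projection [pr] along this closure they fit
    together exactly, and [pr] changes no value of a continuous seminorm. The
    polynomials obtained on [E] are continuous because they satisfy Lipschitz
    estimates on balls of any given radius, the same in all [En n]. *)
Lemma limit_expansion : exists p : nat -> E -> F,
  (forall k, homogeneous_poly k (p k) /\ continuous (p k)) /\
  \forall x \near incl 0 a, series (fun k => p k (x - incl 0 a)) @ \oo --> f x.
Proof.
pose rho := (r - rnorm a) / 2.
have rho0 : 0 < rho by rewrite divr_gt0 ?subr_gt0.
have rhoE : 2 * rho = r - rnorm a by rewrite /rho; field.
clearbody rho.
have exA n : {b : En n | incl n b = incl 0 a}.
  by apply: cid; have [b ? _] := lift_le sys a (leq0n n); exists b.
pose an n := projT1 (exA n).
have anE n : incl n (an n) = incl 0 a by exact: projT2 (exA n).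
have anr n : rnorm (an n) <= rnorm a := rnorm_lift sys (leq0n n) (anE n).
have anr' n : rnorm (an n) < r by exact: le_lt_trans (anr n) ar.
pose pn n := projT1 (cid (analytic_expansion (@fn_analytic n) (anr' n))).
have pnE n : expansion (f \o incl n) (pn n) (an n).
  exact: projT2 (cid (analytic_expansion (@fn_analytic n) (anr' n))).
have [pr prL [prN pr0]] := exists_projection (@cseminorm_null_subspace _ F).
have prB x y : pr (x - y) = pr x - pr y.
  by rewrite [x - y]addrC -(scaleN1r y) prL scaleN1r addrC.
have q_pr q x : cseminorm q -> q (pr x) = q x.
  move=> qc; have qS := qc.1; apply/eqP; rewrite eq_le.
  have h := prN x q qc; have h' : q (x - pr x) = 0 by rewrite (snormBC qS).
  rewrite (le_trans (snorm_leD qS _ x)) ?h ?addr0 //=.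
  by rewrite (le_trans (snorm_leD qS _ (pr x))) // h' addr0.
have line n q u : cseminorm q -> forall z, rnorm z < rho / (rnorm u + 1) ->
    hassum q (fun k => pn n k u) z (f (incl 0 a + z *: incl n u)).
  move=> qc z zr; have [M M0 HM] := ball_image_bounded n qc.
  have u1 : 0 < rnorm u + 1 by rewrite ltr_wpDl // rnorm_ge0.
  have aT : rnorm (an n) + rho / (rnorm u + 1) * rnorm u <= r.
    have : rho / (rnorm u + 1) * rnorm u <= rho.
      by rewrite mulrAC ler_pdivrMr // ler_pM2l // lerDl.
    by have := anr n; lra.
  have := expansion_disc (@fn_analytic n) qc HM (pnE n) aT (anr' n) zr.
  by rewrite /= linearD linearZ /= anE.
have compat k n (u : En n) : pr (pn n.+1 k (bond n u)) = pr (pn n k u).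
  apply/eqP; rewrite -subr_eq0 -prB; apply/eqP; apply: pr0 => q qc.
  have [_ bondE _ bond1 _] := sys.
  have u1 : 0 < rnorm u + 1 by rewrite ltr_wpDl // rnorm_ge0.
  have t0 : 0 < rho / (rnorm u + 1) by rewrite divr_gt0.
  apply: (hassum_coef_unique qc.1 (c := fun k => pn n.+1 k (bond n u))
    k t0 _ (line n q u qc)) => z zt.
  have := line n.+1 q (bond n u) qc z; rewrite bondE; apply.
  apply: (lt_le_trans zt); rewrite ler_pM2l // lef_pV2 ?posrE ?lerD2r //.
  by rewrite ltr_wpDl // rnorm_ge0.
have [P HP] := choice (fun k =>
  glue_limit sys (h := fun n u => pr (pn n k u)) (compat k)).
exists P; split=> [k|].
  have PnE n : P k \o incl n = pr \o pn n k by apply/funext => u; exact: HP.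
  split.
    apply: (homogeneous_poly_limit sys) => n; rewrite PnE.
    have [b [bL bp]] := (pnE n).1 k.
    exists (pr \o b); split=> [i v c x y|x] /=; last by rewrite bp.
    by rewrite bL prL.
  move=> x; have [_ _ surj _ _] := sys; have [m [x0 <-]] := surj x.
  (* Dropping the first [m] spaces brings [x] into the first one. *)
  have sysm := contractive_limit_shift m sys.
  apply: (@lipschitz_continuous_at _ _ _ _ _ sysm _ (P k) x0 1 ltr01).
  move=> q qc n; have qS := qc.1.
  have [M M0 HM] := ball_image_bounded (n + m) qc.
  pose sigma := rnorm x0 + 1.
  have s0 : 0 < sigma by rewrite ltr_wpDl // rnorm_ge0.
  pose t := rho / sigma.
  have t0 : 0 < t by rewrite divr_gt0.
  exists (8 * M / rho * t / t ^+ k); split.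
    by rewrite !(mulr_ge0, invr_ge0, exprn_ge0) // ltW.
  move=> b bx y z y1 z1; rewrite !HP -prB q_pr // mulrAC.
  have bs : rnorm b <= rnorm x0 := rnorm_lift sys (leq_addl n m) bx.
  rewrite ler_pdivlMr ?exprn_gt0 //.
  have ts : t * sigma <= rho by rewrite divfK // gt_eqF.
  have ys : rnorm (b + y) <= sigma.
    by rewrite (le_trans (rnormD _ _)) // lerD // ltW.
  have zs : rnorm (b + z) <= sigma.
    by rewrite (le_trans (rnormD _ _)) // lerD // ltW.
  have ar2 : rnorm (an (n + m)) + 2 * rho <= r.
    by have := anr (n + m)%N; lra.
  have := expansion_lipschitz (@fn_analytic (n + m)) qc HM k
    (pnE (n + m)%N) rho0 ar2 t0 ts ys zs.
  by rewrite opprD addrACA subrr add0r.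
have := nbhs_translate (incl 0 a) (nbhs_limit_ball sys rho0).
apply: filterS => x [n [u [xu ur]]].
apply: hassum_cvg => q qc; have qS := qc.1.
have [M M0 HM] := ball_image_bounded n qc.
have aT : rnorm (an n) + 2 * rnorm u <= r.
  by have := anr n; lra.
have z1 : rnorm (1 : R[i]) < 2 by rewrite rnorm1; lra.
have := expansion_disc (@fn_analytic n) qc HM (pnE n) aT (anr' n) z1.
rewrite /= scale1r linearD /= anE -xu subrKC.
apply: (hassum_eq qS) => e e0; apply: nearW => K.
rewrite psumB (le_trans (snorm_sum qS _ _ _)) // big1 ?(ltW e0) // => k _.
by rewrite (snormZ qS) xu HP (snormBC qS) prN // mulr0.
Qed.

End LimitAnalytic.

Theorem theoremA (R : realType)
  (E : tvsType R[i]) (En : nat -> normedModType R[i])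
  (incl : forall n, {linear En n -> E})
  (incl_inj : forall n, injective (incl n))
  (bond : forall n, {linear En n -> En n.+1})
  (bondE : forall n (x : En n), incl n.+1 (bond n x) = incl n x)
  (E_union : \bigcup_n range (incl n) = [set: E])
  (bond_continuous : forall n, continuous (bond n))
  (bond_norm : forall n, (op_norm (bond n) <= 1)%E)
  (E_limit : lc_direct_limit incl)
  (E_hausdorff : hausdorff_space E)
  (r : R) (r_gt0 : 0 < r)
  (F : tvsType R[i]) (f : E -> F)
  (fn_analytic : forall n, analytic_on (ball (0 : En n) r%:C) (f \o incl n))
  (fn_bounded : forall n,
    tvs_bounded ((f \o incl n) @` ball (0 : En n) r%:C)) :
  analytic_on (\bigcup_n (incl n @` ball (0 : En n) r%:C)) f.
Proof.
have sys : contractive_limit incl bond.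
  split=> // [x|n]; last exact: op_norm_contraction.
  have : [set: E] x by [].
  by rewrite -E_union => -[n _ [u _ ux]]; exists n, u.
have local a : (\bigcup_n (incl n @` ball (0 : En n) r%:C)) a ->
    [/\ nbhs a (\bigcup_n (incl n @` ball (0 : En n) r%:C)),
      {for a, continuous f} & exists p : nat -> E -> F,
      (forall k, homogeneous_poly k (p k) /\ continuous (p k)) /\
      \forall x \near a, series (fun k => p k (x - a)) @ \oo --> f x].
  move=> [m _ [a0 /rnorm_ball ar <-]].
  (* Dropping the first [m] spaces brings [a] into the first one. *)
  have sysm := contractive_limit_shift m sys.
  have fa n := fn_analytic (n + m)%N; have fb n := fn_bounded (n + m)%N.
  split.
  - apply: filterS (@nbhs_union_balls _ _ _ _ _ sysm r a0 ar) => x [n _ Hx].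
    by exists (n + m)%N.
  - exact: (@limit_continuous _ _ _ _ _ _ sysm r f a0 ar fa fb).
  - exact: (@limit_expansion _ _ _ _ _ _ sysm r f a0 ar fa fb).
split.
- by rewrite openE => a /local[].
- by apply: continuous_in_subspaceT => a; rewrite inE => /local[].
- by move=> a /local[].
Qed.
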